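(* Let $\Omega\subseteq\mathbb C$ be a domain, let $m,n\ge1$ be integers, put $N=mn$, and let $\mathcal W\subset L^2(\Omega,\mathbb R^N)$ be a subspace. Let $\mathcal A\colon\mathcal W\to L^2(\Omega,\mathbb R^N)$ be a fixed (deterministic) operator that commutes with linear maps, i.e. for all $f\in\mathcal W$ and all $B\in\mathbb R^{N\times N}$ one has $Bf\in\mathcal W$ and $\mathcal A(Bf)=B\,\mathcal A(f)$. Let $f\in\mathcal W$ with $f-\mathcal A(f)\ne0$, and let $\rho$ denote the stable rank of $f-\mathcal A(f)$. Let $V=v\otimes u\in\mathbb R^{N}$ (regarded as an $N\times1$ matrix), where $u\in\mathbb R^m$ and $v\in\mathbb R^n$ are independent real Gaussian random vectors (i.i.d. $N(0,1)$ entries). Then for any $\tau>1$ we have $$\mathrm{Prob}\big(\|f-\mathcal A(f)\|\ge\tau\sqrt{\rho}\,\|V^Tf-\mathcal A(V^Tf)\|\big)\le\frac{2}{\pi}\,\big(2+\ln(1+2\tau)\big)\,\tau^{-1}$$ and $$\mathrm{Prob}\big(\|f-\mathcal A(f)\|\le\tau^{-1}\,\|V^Tf-\mathcal A(V^Tf)\|\big)\le\sqrt{2\tau}\,\exp(-\tau+2).$$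
   Context: Norms. For an integer $k\ge1$ and $h\in L^2(\Omega,\mathbb R^k)$, $\|h\|^2:=\int_\Omega\|h(z)\|_2^2\,\mathrm dz$, where $\|\cdot\|_2$ is the Euclidean norm and $\mathrm dz$ is Lebesgue measure on $\Omega\subseteq\mathbb C\cong\mathbb R^2$. For a matrix $B$, $Bf$ denotes the function $z\mapsto Bf(z)$; likewise $V^Tf$ is the scalar function $z\mapsto V^Tf(z)$. The symbol $\otimes$ is the Kronecker product, so that $(v\otimes u)^T\mathrm{vec}(X)=u^TXv$ for $X\in\mathbb R^{m\times n}$, with $\mathrm{vec}$ stacking columns. Singular values and stable rank. Every $h\in L^2(\Omega,\mathbb R^N)$ induces the operator $\mathcal L_h\colon L^2(\Omega,\mathbb R)\to\mathbb R^N$, $\mathcal L_hw=\int_\Omega h(z)w(z)\,\mathrm dz$, which has rank at most $N$. There are orthonormal $u_1,\dots,u_N\in\mathbb R^N$, orthonormal $v_1,\dots,v_N\in L^2(\Omega,\mathbb R)$ and uniquely determined singular values $\sigma_1\ge\dots\ge\sigma_N\ge0$ with $h(z)=\sum_{j=1}^N\sigma_ju_jv_j(z)$; in particular $\sigma_1$ is the operator norm of $\mathcal L_h$, and $\|h\|^2=\sigma_1^2+\dots+\sigma_N^2$. The stable rank of $h\neq0$ is $\rho:=\|h\|^2/\sigma_1^2$. Convention for $\mathcal A$ on shorter vectors. For $k<N$ and $\widetilde f\colon\Omega\to\mathbb R^k$ such that the zero-padded function $\binom{\widetilde f}{0}\colon\Omega\to\mathbb R^N$ lies in $\mathcal W$,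 the commutation property implies that $\mathcal A\binom{\widetilde f}{0}=\binom{\widetilde g}{0}$ for some $\widetilde g\colon\Omega\to\mathbb R^k$, and one writes $\mathcal A(\widetilde f):=\widetilde g$. This defines $\mathcal A(V^Tf)$ (with $k=1$); if $N=1$, $\mathcal A$ is applied directly. *)

(* Defs.v *)
From HB Require Import structures.
From mathcomp Require Import all_boot all_order all_algebra.
From mathcomp Require Import mxtens.
From mathcomp Require Import all_classical all_reals all_analysis.
Set Implicit Arguments.
Unset Strict Implicit.
Unset Printing Implicit Defensive.
Import Order.TTheory GRing.Theory Num.Theory.
Import numFieldNormedType.Exports.
Local Open Scope classical_set_scope.
Local Open Scope ring_scope.

(* The complex plane, identified with R * R and carrying the product Borel
   sigma-algebra on which [lebesgue_measure \x lebesgue_measure] lives. *)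
Definition plane (R : realType) : Type :=
  (measurableTypeR R * measurableTypeR R)%type.

Definition plane_measure (R : realType) : {measure set (plane R) -> \bar R} :=
  (@lebesgue_measure R \x @lebesgue_measure R)%E.

Definition plane_domain (R : realType) (Om : set (plane R)) : Prop :=
  [/\ open Om, connected Om & Om !=set0].

(* Elements of L^2(Om, R^k) are represented by functions on the whole plane:
   values outside Om are irrelevant, and equality in L^2 is [L2_eq]. *)
Definition L2 (R : realType) (Om : set (plane R)) (k : nat) :
    set (plane R -> 'cV[R]_k) :=
  [set h : plane R -> 'cV[R]_k | forall i,
    measurable_fun Om (fun z => h z i 0) /\
    (plane_measure R).-integrable Om (fun z => ((h z i 0) ^+ 2)%:E)].

Definition L2_eq (R : realType) (Om : set (plane R)) (k : nat)
    (f g : plane R -> 'cV[R]_k) : Prop :=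
  {ae plane_measure R, forall z, Om z -> f z = g z}.

Definition L2_norm (R : realType) (Om : set (plane R)) (k : nat)
    (h : plane R -> 'cV[R]_k) : R :=
  Num.sqrt (\int[plane_measure R]_(z in Om) (\sum_(i < k) (h z i 0) ^+ 2)).

(* A linear subspace of L^2; the last clause makes it a set of a.e. classes. *)
Definition L2_subspace (R : realType) (Om : set (plane R)) (k : nat)
    (W : set (plane R -> 'cV[R]_k)) : Prop :=
  [/\ W `<=` L2 Om (k := k),
      W (fun=> 0),
      forall (a : R) f g, W f -> W g -> W (fun z => a *: f z + g z)
    & forall f g, W f -> L2 Om g -> L2_eq Om f g -> W g].

(* A map W -> L^2, not assumed linear, that is well defined on a.e. classes. *)
Definition L2_operator (R : realType) (Om : set (plane R)) (k : nat)
    (W : set (plane R -> 'cV[R]_k))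
    (A : (plane R -> 'cV[R]_k) -> (plane R -> 'cV[R]_k)) : Prop :=
  (forall f, W f -> L2 Om (A f)) /\
  (forall f g, W f -> W g -> L2_eq Om f g -> L2_eq Om (A f) (A g)).

Definition commutes_with_linear_maps (R : realType) (Om : set (plane R))
    (k : nat) (W : set (plane R -> 'cV[R]_k))
    (A : (plane R -> 'cV[R]_k) -> (plane R -> 'cV[R]_k)) : Prop :=
  forall f (B : 'M[R]_k), W f ->
    W (fun z => B *m f z) /\
    L2_eq Om (A (fun z => B *m f z)) (fun z => B *m A f z).

Definition zero_pad (R : realType) (k N : nat) (w : plane R -> 'cV[R]_k) :
    plane R -> 'cV[R]_N :=
  fun z => \col_i (if insub (val i) is Some j then w z j 0 else 0).

(* The operator on shorter vectors (k <= N): A (w ; 0) has the form (g ; 0)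
   (see [short_opE]) and the value is g.  For k = N this is A itself. *)
Definition short_op (R : realType) (k N : nat) (kN : (k <= N)%N)
    (A : (plane R -> 'cV[R]_N) -> (plane R -> 'cV[R]_N))
    (w : plane R -> 'cV[R]_k) : plane R -> 'cV[R]_k :=
  fun z => \col_j A (zero_pad N w) z (widen_ord kN j) 0.

Lemma muln_pos (m n : nat) : (0 < m)%N -> (0 < n)%N -> (0 < n * m)%N.
Proof. by move=> m0 n0; rewrite muln_gt0 m0 n0. Qed.

Lemma short_opE (R : realType) (Om : set (plane R)) (k N : nat)
    (kN : (k <= N)%N) (W : set (plane R -> 'cV[R]_N))
    (A : (plane R -> 'cV[R]_N) -> (plane R -> 'cV[R]_N)) (w : plane R -> 'cV[R]_k) :
  commutes_with_linear_maps Om W A -> W (zero_pad N w) ->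
  L2_eq Om (A (zero_pad N w)) (zero_pad N (short_op kN A w)).
Proof.
move=> AB Ww; pose B : 'M[R]_N := \matrix_(i, j) ((i == j) && (i < k)%N)%:R.
have BE (x : 'cV[R]_N) i : (B *m x) i 0 = if (i < k)%N then x i 0 else 0.
  rewrite mxE (bigD1 i)//= mxE eqxx big1 ?addr0 => [|j ji].
    by case: ifP => _; rewrite ?mul1r ?mul0r.
  by rewrite mxE eq_sym (negbTE ji) mul0r.
have Bw : (fun z => B *m zero_pad N w z) = zero_pad N w.
  apply/funext => z; apply/colP => i; rewrite BE mxE.
  by case: insubP => [j -> //|/negbTE ->].
have [_] := AB _ B Ww; rewrite Bw; apply: filterS => z zE /zE ->.
apply/colP => i; rewrite BE [RHS]mxE.
case: insubP => [j -> ji|/negbTE ->]//.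
by rewrite /short_op mxE; congr (A _ _ _ _); apply/val_inj.
Qed.

(* h = \sum_j s_j u_j v_j with u, v orthonormal and s_1 >= ... >= s_k >= 0. *)
Definition is_singular_values (R : realType) (Om : set (plane R)) (k : nat)
    (h : plane R -> 'cV[R]_k) (s : k.-tuple R) : Prop :=
  exists (u : 'I_k -> 'cV[R]_k) (v : 'I_k -> plane R -> R),
  [/\ forall i j, \sum_(l < k) u i l 0 * u j l 0 = (i == j)%:R,
      forall j, L2 Om (fun z => const_mx (v j z) : 'cV[R]_1),
      forall i j, \int[plane_measure R]_(z in Om) (v i z * v j z)
                  = (i == j)%:R,
      (forall j, 0 <= tnth s j) /\
      (forall i j : 'I_k, (i <= j)%N -> tnth s j <= tnth s i)
    & L2_eq Om h (fun z => \sum_(j < k) (tnth s j * v j z) *: u j)].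

(* Such an s always exists and is unique, so the default is never used. *)
Definition singular_values (R : realType) (Om : set (plane R)) (k : nat)
    (h : plane R -> 'cV[R]_k) : k.-tuple R :=
  xget [tuple of nseq k 0] (is_singular_values Om h).

Definition stable_rank (R : realType) (Om : set (plane R)) (k : nat)
    (h : plane R -> 'cV[R]_k) : R :=
  L2_norm Om h ^+ 2 / (head 0 (singular_values Om h)) ^+ 2.

Definition mutually_independent (d : measure_display) (T : measurableType d)
    (R : realType) (P : probability T R) (I : finType)
    (X : I -> {RV P >-> R}) : Prop :=
  forall (J : {set I}) (E : I -> set R), (forall i, measurable (E i)) ->
    P (\bigcap_(i in [set` J]) (X i @^-1` E i))
    = (\prod_(i in J) P (X i @^-1` E i))%E.

Definition standard_normal (d : measure_display) (T : measurableType d)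
    (R : realType) (P : probability T R) (X : {RV P >-> R}) : Prop :=
  forall E : set R, measurable E -> distribution P X E = normal_prob 0 1 E.

(* u, v are independent Gaussian vectors with i.i.d. N(0,1) entries: all
   entries are N(0,1), and the whole family (u_i)_i, (v_j)_j is independent. *)
Definition independent_gaussian_vectors (d : measure_display)
    (T : measurableType d) (R : realType) (P : probability T R) (m n : nat)
    (u : 'I_m -> {RV P >-> R}) (v : 'I_n -> {RV P >-> R}) : Prop :=
  [/\ forall i, standard_normal (u i),
      forall j, standard_normal (v j)
    & mutually_independent
        (fun l : 'I_m + 'I_n => match l with inl i => u i | inr j => v j end)].

(* v (x) u: the entry at position j * m + i is v_j * u_i, which matches vec
   stacking the columns of an m x n matrix. *)
Definition kron_vector (d : measure_display)
    (T : measurableType d) (R : realType) (P : probability T R) (m n : nat)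
    (u : 'I_m -> {RV P >-> R}) (v : 'I_n -> {RV P >-> R}) (t : T) :
    'cV[R]_(n * m) :=
  (\col_j v j t) *t (\col_i u i t).

(* Main.v *)
Require Import Defs.
From mathcomp Require Import all_boot all_order all_algebra.
From mathcomp Require Import mxtens.
From mathcomp Require Import all_classical all_reals all_analysis.
From mathcomp Require Import measurable_realfun ring lra.
Set Implicit Arguments.
Unset Strict Implicit.
Unset Printing Implicit Defensive.
Import Order.TTheory GRing.Theory Num.Theory.
Import numFieldNormedType.Exports.
Local Open Scope classical_set_scope.
Local Open Scope ring_scope.

(** Put [h = f - A f].  Commutation with the matrix whose first row is [V^T]
    and whose other rows vanish gives [V^T f - A (V^T f) = V^T h], so for a
    singular value decomposition [h = \sum_j s_j v_j u_j] the two norms are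
      [err ^+ 2 = \sum_j s_j ^+ 2]   and
      [err_V ^+ 2 = \sum_j s_j ^+ 2 * Z_j ^+ 2],
    where [Z_j] is the inner product of [u_j] with the Kronecker product of
    the two Gaussian vectors.  Reshaping the unit vector [u_j] into a matrix
    [X] of Frobenius norm one, [Z_j] is the Gaussian bilinear form [u^T X v].

    Since [sqrt rho = err / s_0], the first event forces [|Z_0| <= tau^-1]:
    only the leading term of [err_V] matters.  The second event says that the
    weighted mean of the [Z_j ^+ 2], with weights [s_j ^+ 2 / err ^+ 2], is at
    least [tau ^+ 2].  So everything reduces to a small ball estimate
    ([bilinear_small_ball]) and a tail estimate ([bilinear_tail]) for bilinear
    forms.

    Given [v], the variable [Z] is a centred normal of variance [q = |X v|^2]
    ([integral_bilinear]), and both estimates rest on one fact about [q]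
    ([gaussian_quadratic_form_le]):
      [E exp (- k q / 2) <= 1 / sqrt (1 + k)]   for every [k > -1].
    In a basis diagonalizing [X^T X] the left side is the product of the
    [(1 + k a_i)^(-1/2)] over its eigenvalues [a_i], whose sum is [1], so the
    bound only says that [\prod (1 + k a_i) >= 1 + k], with equality for [X]
    of rank one.  Diagonalization can be bypassed: integrating out one
    coordinate of [v] replaces the form by a Schur complement, and the same
    inequality between traces holds at each step.

    For the small ball, the probability that a centred normal of variance [q]
    is at most [e = tau^-1] in absolute value is bounded by
      [sqrt (2 / pi) * e / sqrt (q + e^2 / 3)
         = e / pi * \int exp (- x^2 (q + e^2 / 3) / 2) dx].
    Averaging over [v] under the integral sign and using the key fact with
    [k = x^2] leaves [\int exp (- x^2 e^2 / 6) / sqrt (1 + x^2) dx], which is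
    at most [2 (2 + ln (2 tau))] ([damped_integral_le]).

    For the tail, apply Markov's inequality to [cosh (theta * sqrt _)] with
    [theta = 1 - tau^-1].  This function is convex, because the power series
    of [cosh] has only even terms, with nonnegative coefficients
    ([cosh_sqrt_convex]), so the weighted mean may be taken outside, and
    [E cosh (theta Z_j) = E exp (theta^2 q / 2) <= 1 / sqrt (1 - theta^2)] by
    the key fact with [k = - theta^2].

    The singular values of the statement are chosen among all families
    satisfying their specification, so a decomposition must be exhibited.  The
    left singular vectors come from successive maximization of the Gram form
    of the coordinates of [h] on spheres ([form_orthogonal_basis]).  Each
    right singular vector is [u_j^T h / s_j] when [s_j > 0]; the others are
    supplied by the infinite dimension of [L^2] of a nonempty open set
    ([complete_orthonormal]). *)

(** * Integrating out one variable of an independent family *)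

Section independent_family.
Context (d : measure_display) (T : measurableType d) (R : realType).
Context (P : probability T R) (I : finType) (X : I -> {RV P >-> R}).
Hypothesis indX : mutually_independent X.

(** The finite-dimensional events in the variables of [J]: a pi-system that
    generates the sigma-algebra of these variables. *)
Definition cylinders (J : {set I}) : set (set T) :=
  [set \bigcap_(i in [set` J]) (X i @^-1` E i) |
     E in [set E : I -> set R | forall i, measurable (E i)]].

Let measurable_preX i (E : set R) : measurable E -> measurable (X i @^-1` E).
Proof. by move=> mE; rewrite -[_ @^-1` _]setTI; exact: measurable_funP. Qed.

Lemma cylinders_measurable J : cylinders J `<=` measurable.
Proof.
move=> _ [E mE <-]; apply: fin_bigcap_measurable; first exact: finite_finset.
by move=> i _; apply: measurable_preX; exact: mE.
Qed.

Lemma cylindersT J : cylinders J setT.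
Proof.
exists (fun=> setT); first by move=> i; exact: measurableT.
by apply/seteqP; split => // t _ i _.
Qed.

Lemma cylindersI J : setI_closed (cylinders J).
Proof.
move=> _ _ [E mE <-] [F mF <-].
exists (fun i => E i `&` F i); first by move=> i; exact: measurableI.
apply/seteqP; split => [t EF|t [Et Ft] i iJ].
  by split => i iJ; have [] := EF i iJ.
by split; [exact: Et|exact: Ft].
Qed.

Notation Xsigma J := (g_sigma_algebraType (cylinders J)).

Lemma Xsigma_sub J (A : set T) :
  measurable (A : set (Xsigma J)) -> measurable A.
Proof.
apply: smallest_sub; first exact: sigma_algebra_measurable.
exact: cylinders_measurable.
Qed.

Lemma measurable_Xsigma (J : {set I}) i : i \in J ->
  measurable_fun setT (X i : Xsigma J -> R).
Proof.
move=> iJ _ E mE; rewrite setTI; apply: sub_sigma_algebra.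
exists (fun j => if j == i then E else setT).
  by move=> j; case: ifP.
apply/seteqP; split => [t /(_ i iJ)|t Et j _] /=; first by rewrite eqxx.
by case: eqP => // ->.
Qed.

Lemma measurable_of_Xsigma (J : {set I}) (f : T -> R) :
  measurable_fun setT (f : Xsigma J -> R) -> measurable_fun setT f.
Proof.
move=> mf _ B mB; rewrite setTI; apply: (@Xsigma_sub J).
by have := mf measurableT B mB; rewrite setTI.
Qed.

(** Independence passes from the cylinders to the sigma-algebra that they
    generate: both sides are finite measures in [A], and they agree on a
    pi-system containing the whole space. *)
Lemma Xsigma_indep (J : {set I}) k (A : set T) (B : set R) : k \notin J ->
  measurable (A : set (Xsigma J)) -> measurable B ->
  P (A `&` X k @^-1` B) = (P A * P (X k @^-1` B))%E.
Proof.
move=> kJ mA mB.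
have mXB := measurable_preX k mB.
have r0 : 0 <= fine (P (X k @^-1` B)) by rewrite fine_ge0.
pose m1 : {measure set T -> \bar R} := mrestr P mXB.
pose m2 : {measure set T -> \bar R} := mscale (NngNum r0) P.
suff -> : P (A `&` X k @^-1` B) = m2 A.
  by rewrite /m2 /= /mscale /= fineK ?fin_num_measure// muleC.
rewrite -[LHS]/(m1 A).
apply: (@g_sigma_algebra_measure_unique _ _ _ (cylinders J) _ (fun=> setT)) => //.
- exact: cylinders_measurable.
- by move=> _; exact: cylindersT.
- by rewrite bigcup_const.
- exact: cylindersI.
- move=> _ [E mE <-]; rewrite /m1 /m2 /= /mscale /mrestr /=.
  rewrite fineK ?fin_num_measure//.
  pose E' i := if i == k then B else E i.
  have mE' i : measurable (E' i) by rewrite /E'; case: ifP.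
  have EE' i : i \in J -> E' i = E i.
    by rewrite /E' => iJ; case: eqP => // ik; move: kJ; rewrite -ik iJ.
  have -> : \bigcap_(i in [set` J]) (X i @^-1` E i) `&` X k @^-1` B =
            \bigcap_(i in [set` (k |: J)%SET]) (X i @^-1` E' i).
    apply/seteqP; split => [t [Et Bt] i /=|t Et].
      rewrite !inE => /predU1P[->|iJ]; first by rewrite /E' eqxx.
      by rewrite EE'//; exact: Et.
    split=> [i iJ|]; first by rewrite -EE'//; apply: Et; rewrite /= inE orbC iJ.
    by have := Et k; rewrite /= /E' eqxx; apply; rewrite !inE eqxx.
  rewrite indX// big_setU1//= {1}/E' eqxx; congr (_ * _)%E.
  by rewrite indX//; apply: eq_bigr => i /EE' ->.
- by move=> k'; apply: le_lt_trans (probability_le1 P _) (ltry _); exact: measurableI.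
Qed.

Hypothesis normX : forall i, standard_normal (X i).

(** Conditioning on the variables of [J]: the joint law of the point of [T],
    seen through the sigma-algebra of [J], and of [X k] is the product of [P]
    with the standard normal law, so Tonelli's theorem applies to any
    integrand that depends on the sample point only through [X_j], [j] in
    [J].  This is how a Gaussian variable is eliminated below. *)
Lemma integral_peel (J : {set I}) k (F : Xsigma J * measurableTypeR R -> \bar R) :
  k \notin J -> measurable_fun setT F -> (forall z, 0 <= F z)%E ->
  (\int[P]_t F (t, X k t) = \int[P]_t \int[normal_prob 0 1]_x F (t, x))%E.
Proof.
move=> kJ mF F0.
have mid : measurable_fun setT (id : T -> Xsigma J).
  by move=> _ A mA; rewrite setTI preimage_id; exact: (@Xsigma_sub J).
pose PJ : probability (Xsigma J) R := distribution P (mfun_Sub (mem_set mid)).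
have mXk : measurable_fun setT (X k : T -> measurableTypeR R).
  by move=> _ B mB; rewrite setTI; exact: measurable_preX.
have mphi : measurable_fun setT
    (fun t : T => (t : Xsigma J, X k t : measurableTypeR R)).
  exact: measurable_fun_pair.
pose PX : probability (Xsigma J * measurableTypeR R)%type R :=
  distribution P (mfun_Sub (mem_set mphi)).
have PXE : forall A, measurable A -> (PJ \x normal_prob 0 1)%E A = PX A.
  apply: (@product_measure_unique _ _ _ _ _ PJ (normal_prob 0 1) PX) => A B mA mB.
  rewrite /PX /PJ /distribution /pushforward/=.
  by rewrite -(normX k)//; exact: (Xsigma_indep kJ mA mB).
transitivity (\int[PX]_z F z)%E; first by rewrite ge0_integral_pushforward.
rewrite (eq_measure_integral (PJ \x normal_prob 0 1)%E); last first.
  by move=> A mA _; rewrite [RHS]PXE.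
rewrite fubini_tonelli1//.
rewrite ge0_integral_pushforward//=.
  exact: measurable_fun_fubini_tonelli_F.
by move=> t _; exact: integral_ge0.
Qed.

End independent_family.

(** * Integrals against normal laws *)

Section gaussian_integrals.
Context {R : realType}.
Local Notation mu := (@lebesgue_measure R).

Lemma ge0_integral_normal_prob (m s : R) (f : measurableTypeR R -> \bar R) :
  measurable_fun setT f -> (forall x, 0 <= f x)%E ->
  (\int[normal_prob m s]_x f x = \int[mu]_x (f x * (normal_pdf m s x)%:E))%E.
Proof.
move=> mf f0; have dom := normal_prob_dominates m s.
rewrite -(Radon_Nikodym_SigmaFinite.change_of_variables dom)//.
apply: ae_eq_integral => //.
- apply: emeasurable_funM => //.
  exact: (measurable_int _ (Radon_Nikodym_SigmaFinite.f_integrable dom)).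
- apply: emeasurable_funM => //; apply/measurable_EFinP.
  exact: measurable_normal_pdf.
- apply: ae_eqe_mul2l; apply: integral_ae_eq => //.
  + exact: Radon_Nikodym_SigmaFinite.f_integrable.
  + by apply/measurable_EFinP; exact: measurable_normal_pdf.
  + by move=> A _ mA; rewrite -Radon_Nikodym_SigmaFinite.f_integral.
Qed.

Lemma normal_peakE (s : R) : normal_peak s = (`|s| * Num.sqrt (pi *+ 2))^-1.
Proof. by rewrite /normal_peak -mulrnAr sqrtrM ?sqr_ge0// sqrtr_sqr. Qed.

(** Lebesgue measure is determined by its values on intervals, and an affine
    map multiplies those by the modulus of its slope. *)
Lemma ge0_integral_affine (c s : R) (f : measurableTypeR R -> \bar R) : s != 0 ->
  measurable_fun setT f -> (forall x, 0 <= f x)%E ->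
  (\int[mu]_x f x = `|s|%:E * \int[mu]_x f (c + s * x)%R)%E.
Proof.
move=> s0 mf f0; pose g (x : measurableTypeR R) : measurableTypeR R := c + s * x.
have mg : measurable_fun setT g.
  by apply: measurable_funD => //; exact: measurable_funM.
pose nu_ : {measure set (measurableTypeR R) -> \bar R} :=
  mscale (NngNum (normr_ge0 s)) (pushforward mu g).
pose nu := nu_ mg.
rewrite (eq_measure_integral nu) => [|A mA _]; last first.
  apply: (lebesgue_measure_unique _ mA) => _ [[a b] _ <-].
  rewrite /nu /nu_ /= /mscale /= /pushforward /=.
  have [ba|ab] := leP b a.
    by rewrite set_itv_ge ?bnd_simp -?leNgt// preimage_set0 !measure0 mule0.
  have [s_lt0|s_gt0|s_eq0] := ltgtP s 0; last by rewrite s_eq0 eqxx in s0.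
  - rewrite (_ : g @^-1` _ = `[(b - c) / s, (a - c) / s[%classic); last first.
      apply/seteqP; split => x /=; rewrite !in_itv/= /g;
      by rewrite ler_ndivrMr// ltr_ndivlMr// ltrBlDl lerBrDl mulrC andbC.
    rewrite !lebesgue_measure_itv/= !lte_fin ab ltr_ndivrMr// divfK//.
    rewrite ltrD2r ab ltr0_norm// -!EFinD -EFinM; congr (_%:E).
    by field.
  - rewrite (_ : g @^-1` _ = `](a - c) / s, (b - c) / s]%classic); last first.
      apply/seteqP; split => x /=; rewrite !in_itv/= /g;
      by rewrite ler_pdivlMr// ltr_pdivrMr// ltrBlDl lerBrDl mulrC.
    rewrite !lebesgue_measure_itv/= !lte_fin ab ltr_pdivrMr// divfK//.
    rewrite ltrD2r ab gtr0_norm// -!EFinD -EFinM; congr (_%:E).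
    by field.
by rewrite /nu /nu_ ge0_integral_mscale//= ge0_integral_pushforward.
Qed.

Lemma ge0_integral_gauss_affine (c s : R) (f : measurableTypeR R -> \bar R) :
  s != 0 -> measurable_fun setT f -> (forall x, 0 <= f x)%E ->
  (\int[normal_prob 0 1]_x f (c + s * x)%R = \int[normal_prob c s]_x f x)%E.
Proof.
move=> s0 mf f0; have mfa : measurable_fun setT (fun x : measurableTypeR R => f (c + s * x)).
  apply: measurableT_comp => //.
  by apply: measurable_funD => //; exact: measurable_funM.
have -> := @ge0_integral_normal_prob 0 1 (fun x => f (c + s * x)) mfa (fun x => f0 _).
rewrite (ge0_integral_normal_prob c s mf f0).
rewrite [RHS](@ge0_integral_affine c s)//; last 2 first.
- apply: emeasurable_funM => //; apply/measurable_EFinP.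
  exact: measurable_normal_pdf.
- by move=> x; rewrite mule_ge0// lee_fin normal_pdf_ge0.
rewrite -ge0_integralZl//; last 2 first.
- apply: emeasurable_funM.
    apply: measurableT_comp => //.
    by apply: measurable_funD => //; exact: measurable_funM.
  apply/measurable_EFinP; apply: measurableT_comp => //.
    exact: measurable_normal_pdf.
  by apply: measurable_funD => //; exact: measurable_funM.
- by move=> x _; rewrite mule_ge0// lee_fin normal_pdf_ge0.
apply: eq_integral => x _; rewrite muleCA -EFinM; congr (_ * _%:E)%E.
rewrite !normal_pdfE ?oner_neq0//= !normal_peakE /normal_fun normr1 mul1r invfM.
rewrite !mulrA divff ?normr_eq0// mul1r; congr (_ * expR _).
by field.
Qed.

Lemma normal_pdf_abs (m s x : R) : normal_pdf m `|s| x = normal_pdf m s x.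
Proof.
have [->|s0] := eqVneq s 0; first by rewrite normr0.
rewrite !normal_pdfE ?normr_eq0// !normal_peakE normr_id /normal_fun.
by rewrite real_normK ?num_real.
Qed.

(** Completing the square in [y]: the joint density of [y] and [z] is the
    marginal density of [z] times the conditional density of [y] given [z].
    The conditional factor integrates to one, which is why convolving normals
    adds variances. *)
Lemma normal_pdf_convolution (c a r y z : R) : r != 0 ->
  let rho := Num.sqrt (a ^+ 2 + r ^+ 2) in
  normal_pdf (c + a * y) r z * normal_pdf 0 1 y =
  normal_pdf c rho z * normal_pdf (a * (z - c) / rho ^+ 2) (r / rho) y.
Proof.
move=> r0 rho.
have rho2 : rho ^+ 2 = a ^+ 2 + r ^+ 2 by rewrite sqr_sqrtr// addr_ge0 ?sqr_ge0.
have rho2_gt0 : 0 < a ^+ 2 + r ^+ 2.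
  by rewrite ltr_wpDl ?sqr_ge0// exprn_even_gt0.
have rho_gt0 : 0 < rho by rewrite sqrtr_gt0.
have pi0 : Num.sqrt (pi *+ 2) != 0 :> R.
  by rewrite gt_eqF// sqrtr_gt0 mulrn_wgt0// pi_gt0.
have rho0 : rho != 0 by rewrite gt_eqF.
rewrite !normal_pdfE ?oner_neq0// ?mulf_neq0 ?invr_neq0//.
rewrite !normal_peakE /normal_fun mulrACA -expRD [RHS]mulrACA -expRD.
congr (_ * expR _).
  rewrite normr1 mul1r normrM normfV (gtr0_norm rho_gt0); field.
  by rewrite pi0 rho0 normr_eq0.
rewrite exprMn exprVn rho2; field.
by rewrite r0 gt_eqF.
Qed.

(** Stated for possibly vanishing coefficients, where the laws of [a * y] and
    [r * x] may be point masses without a density. *)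
Lemma ge0_integral_gauss_convolution (c a r : R)
    (f : measurableTypeR R -> \bar R) :
  measurable_fun setT f -> (forall x, 0 <= f x)%E ->
  (\int[normal_prob 0 1]_y \int[normal_prob 0 1]_x f (c + a * y + r * x)%R =
   \int[normal_prob 0 1]_x f (c + Num.sqrt (a ^+ 2 + r ^+ 2) * x)%R)%E.
Proof.
move=> mf f0; have [r0|r0] := eqVneq r 0.
  rewrite r0; have [a0|a0] := eqVneq a 0.
    rewrite a0 expr0n/= addr0 sqrtr0.
    under eq_integral do under eq_integral do rewrite !mul0r !addr0.
    under [RHS]eq_integral do rewrite !mul0r !addr0.
    by under eq_integral do rewrite integral_cst//= probability_setT mule1.
  under eq_integral do under eq_integral do rewrite mul0r addr0.
  under eq_integral do rewrite integral_cst//= probability_setT mule1.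
  have na0 : `|a| != 0 by rewrite normr_eq0.
  rewrite expr0n addr0 sqrtr_sqr (ge0_integral_gauss_affine c a0 mf f0).
  rewrite (ge0_integral_gauss_affine c na0 mf f0).
  rewrite (ge0_integral_normal_prob c a mf f0).
  rewrite (ge0_integral_normal_prob c `|a| mf f0).
  by under [RHS]eq_integral do rewrite normal_pdf_abs.
set rho := Num.sqrt _.
have rho0 : rho != 0.
  by rewrite gt_eqF// sqrtr_gt0 ltr_wpDl ?sqr_ge0// exprn_even_gt0.
rewrite (ge0_integral_gauss_affine c rho0 mf f0).
rewrite (ge0_integral_normal_prob c rho mf f0).
(* the law of [c + a * y + r * x] given [y] is normal, of mean [c + a * y] *)
pose G (w : measurableTypeR R * measurableTypeR R) :=
  (f w.2 * (normal_pdf (c + a * w.1) r w.2)%:E)%E.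
have mG : measurable_fun setT G.
  apply: emeasurable_funM; first exact: measurableT_comp.
  apply/measurable_EFinP; rewrite (_ : (fun w => _) = fun w =>
      normal_peak r * normal_fun 0 r (w.2 - (c + a * w.1))).
    apply: measurable_funM => //; apply: measurableT_comp.
      exact: measurable_normal_fun.
    apply: measurable_funB; first exact: measurable_snd.
    by apply: measurable_funD => //; exact: measurable_funM.
  by apply/funext => w; rewrite normal_pdfE// normal_fun_center.
have G0 w : (0 <= G w)%E by rewrite mule_ge0// lee_fin normal_pdf_ge0.
under eq_integral => y _.
  rewrite (ge0_integral_gauss_affine (c + a * y) r0 mf f0).
  rewrite (ge0_integral_normal_prob (c + a * y) r mf f0).
  rewrite (_ : (fun x => _) = (fun z => G (y, z)))//.
  over.
have mpdf m s : measurable_fun setT (fun x : R => (normal_pdf m s x)%:E).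
  by apply/measurable_EFinP; exact: measurable_normal_pdf.
rewrite ge0_integral_normal_prob//=; last 2 first.
- exact: measurable_fun_fubini_tonelli_F.
- by move=> y; exact: integral_ge0.
pose H (w : measurableTypeR R * measurableTypeR R) :=
  (G w * (normal_pdf 0 1 w.1)%:E)%E.
transitivity (\int[mu]_y \int[mu]_z H (y, z))%E.
  apply: eq_integral => y _; rewrite /H -ge0_integralZr//.
  - exact: measurableT_comp.
  - by rewrite lee_fin normal_pdf_ge0.
rewrite fubini_tonelli//; last 2 first.
- apply: emeasurable_funM => //.
  exact: (measurableT_comp (mpdf 0 1) (@measurable_fst _ _ _ _)).
- by move=> w; rewrite mule_ge0// lee_fin normal_pdf_ge0.
apply: eq_integral => z _; rewrite /H /G/=.
under eq_integral => y _.
  rewrite -muleA -EFinM normal_pdf_convolution// -/rho EFinM muleA.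
  over.
rewrite ge0_integralZl//.
- by rewrite integral_normal_pdf mule1.
- exact: mpdf.
- by move=> y _; rewrite lee_fin normal_pdf_ge0.
- by rewrite mule_ge0// lee_fin normal_pdf_ge0.
Qed.

End gaussian_integrals.

(** * Small balls of a centred normal law *)

Section small_ball.
Context {R : realType}.
Local Notation mu := (@lebesgue_measure R).

Lemma integral_is_derive (F f : R -> R) (a b : R) : a < b ->
  (forall x, a <= x <= b -> is_derive x 1 F (f x)) ->
  (forall x, a <= x <= b -> {for x, continuous f}) ->
  (\int[mu]_(x in `[a, b]) (f x)%:E = (F b - F a)%:E)%E.
Proof.
move=> ab dF cf.
have cF x : a <= x <= b -> {for x, continuous F}.
  move=> xab; apply: differentiable_continuous; apply/derivable1_diffP.
  by have [] := dF x xab.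
rewrite (@continuous_FTC2 _ f F)//.
- apply: continuous_in_subspaceT => x; rewrite inE/= in_itv/=; exact: cf.
- split.
  + by move=> x; rewrite in_itv/= => /andP[/ltW ax /ltW xb]; have [] := dF x; rewrite ?ax.
  + by apply: cvg_at_right_filter; apply: cF; rewrite lexx ltW.
  + by apply: cvg_at_left_filter; apply: cF; rewrite lexx ltW.
- move=> x; rewrite in_itv/= => /andP[/ltW ax /ltW xb].
  by rewrite derive1E; apply: derive_val; apply: dF; rewrite ax.
Qed.

(** [(1 + x^2 / a)^(-3/2)] has the antiderivative [x / sqrt (1 + x^2 / a)] for
   every [a]; the value [a = 3] makes it agree with [exp (- x^2 / 2)] to second
   order at the origin. *)
Let D (x : R) := 1 + x ^+ 2 / 3.

Let D_gt0 x : 0 < D x.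
Proof. by rewrite ltr_pwDl// divr_ge0 ?sqr_ge0. Qed.

Let is_derive_D (x : R) :
  is_derive x 1 (fun x => x / Num.sqrt (D x)) (D x * Num.sqrt (D x))^-1.
Proof.
have dD : is_derive x 1 D (2 * x / 3).
  apply: is_derive_eq; rewrite /GRing.scale/=; ring.
have dS : is_derive x 1 (Num.sqrt \o D) ((2 * Num.sqrt (D x))^-1 * (2 * x / 3)).
  by apply: is_derive1_comp => //; exact: is_derive1_sqrt.
have S0 : Num.sqrt (D x) != 0 by rewrite gt_eqF// sqrtr_gt0.
have dV : is_derive x 1 (fun x => (Num.sqrt (D x))^-1)
    (- (Num.sqrt (D x)) ^- 2 *: ((2 * Num.sqrt (D x))^-1 * (2 * x / 3))).
  exact: is_deriveV.
apply: is_derive_eq; rewrite /GRing.scale/=.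
have DE : D x = Num.sqrt (D x) ^+ 2 by rewrite sqr_sqrtr// ltW.
have x2E : x ^+ 2 = 3 * (Num.sqrt (D x) ^+ 2 - 1) by rewrite -DE /D; field.
have -> : D x * Num.sqrt (D x) = Num.sqrt (D x) ^+ 3 by rewrite exprSr -DE.
move: S0 x2E; set S := Num.sqrt (D x) => S0 x2E.
transitivity (S^-1 - x ^+ 2 / 3 * S ^- 3); first by field.
by rewrite x2E; field.
Qed.

(** From [1 + y <= exp y] at [y = x^2 / 3], raised to the power [3/2]. *)
Lemma normal_pdf_le (x : R) :
  normal_pdf 0 1 x <= normal_peak 1 * (D x * Num.sqrt (D x))^-1.
Proof.
rewrite normal_pdfE ?oner_neq0// ler_wpM2l ?normal_peak_ge0//.
rewrite /normal_fun subr0 expr1n mulNr expRN lef_pV2 ?posrE ?expR_gt0//; last first.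
  by rewrite mulr_gt0// sqrtr_gt0.
have DE : D x <= expR (x ^+ 2 / 3) by exact: expR_ge1Dx.
have -> : x ^+ 2 / (1 *+ 2) = x ^+ 2 / 3 + x ^+ 2 / 6 by field.
rewrite expRD ler_pM ?sqrtr_ge0 ?(ltW (D_gt0 x))//.
rewrite (_ : expR (x ^+ 2 / 6) = Num.sqrt (expR (x ^+ 2 / 3))) ?ler_wsqrtr//.
rewrite (_ : x ^+ 2 / 3 = x ^+ 2 / 6 *+ 2); last by field.
by rewrite -[_ *+ 2]mulr_natl expRM_natl sqrtr_sqr ger0_norm// expR_ge0.
Qed.

(** The bound is meaningful for every [s], including [s = 0], and it depends on
    [s] only through the inverse square root of an affine function of the
    variance.  That is what makes it a mixture of exponentials
    ([integral_gauss_weight]), which can be averaged over a random variance. *)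
Lemma gauss_small_ball (s e : R) : 0 < e ->
  (normal_prob 0 1 [set x : R | (`|s * x| <= e)%R] <=
   (Num.sqrt (2 / pi) * e / Num.sqrt (s ^+ 2 + e ^+ 2 / 3))%:E)%E.
Proof.
move=> e0; have pi0 := @pi_gt0 R.
have [->|s0] := eqVneq s 0.
  (* the right side is then [sqrt (6 / pi)], which exceeds one *)
  rewrite (@le_trans _ _ 1%E) ?probability_le1//.
    rewrite (_ : [set x | _] = setT)//; apply/seteqP; split => // x _ /=.
    by rewrite mul0r normr0 ltW.
  rewrite expr0n/= add0r lee_fin (sqrtrM _ (sqr_ge0 e)) sqrtr_sqr gtr0_norm//.
  rewrite (mulrC e) -mulf_div divff ?gt_eqF// mulr1 -[X in X <= _]sqrtr1.
  rewrite sqrtrV// invrK -sqrtrM ?divr_ge0 ?pi_ge0// ler_wsqrtr//.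
  have := @pihalf_lt2 R; rewrite mulrAC ler_pdivlMr//; lra.
pose c := e / `|s|; have c0 : 0 < c by rewrite divr_gt0// normr_gt0.
have -> : [set x : R | (`|s * x| <= e)%R] = `[- c, c]%classic.
  apply/seteqP; split => x /=; rewrite in_itv/= -ler_norml /c normrM;
  by rewrite ler_pdivlMr ?normr_gt0// mulrC.
have cc : - c < c by lra.
pose f x := normal_peak 1 * (D x * Num.sqrt (D x))^-1.
have cf : continuous f.
  move=> x; apply: cvgM; first exact: cvg_cst.
  have cD : D x @[x --> x] --> D x.
    apply: cvgD; first exact: cvg_cst.
    by apply: cvgM; [exact: exprn_continuous|exact: cvg_cst].
  apply: cvgV; first by rewrite mulf_neq0// gt_eqF// sqrtr_gt0.
  apply: cvgM => //.
  by apply: continuous_comp; [exact: cD|exact: sqrt_continuous].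
have dF (x : R) :
    is_derive x 1 (fun x : R => normal_peak 1 * (x / Num.sqrt (D x))) (f x).
  have dFx := is_derive_D x.
  exact: is_derive_eq.
have le_f : (normal_prob 0 1 `[(- c)%R, c]%classic <=
    \int[mu]_(x in `[(- c)%R, c]) (f x)%:E)%E.
  apply: ge0_le_integral => //=.
  - by move=> x _; rewrite lee_fin normal_pdf_ge0.
  - by apply: measurable_funTS; apply/measurable_EFinP; exact: measurable_normal_pdf.
  - apply: measurable_funTS; apply/measurable_EFinP.
    exact: continuous_measurable_fun.
  - by move=> x _; rewrite lee_fin normal_pdf_le.
apply: (le_trans le_f).
rewrite (@integral_is_derive (fun x => normal_peak 1 * (x / Num.sqrt (D x))))
  => [|//|x _]; last exact: cf.
rewrite lee_fin {2}/D sqrrN -/(D c).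
have -> : Num.sqrt (s ^+ 2 + e ^+ 2 / 3) = `|s| * Num.sqrt (D c).
  rewrite -sqrtr_sqr -sqrtrM ?sqr_ge0//; congr Num.sqrt.
  rewrite /D /c exprMn exprVn real_normK ?num_real//; field; rewrite s0.
  by rewrite ?pnatr_eq0.
rewrite normal_peakE normr1 mul1r sqrtrM// sqrtrV ?(ltW pi0)//.
rewrite -[pi *+ 2]mulr_natr sqrtrM ?(ltW pi0)//.
have p0 : Num.sqrt pi != 0 :> R by rewrite gt_eqF// sqrtr_gt0.
have t0 : Num.sqrt 2 != 0 :> R by rewrite gt_eqF// sqrtr_gt0.
have S0 : Num.sqrt (D c) != 0 by rewrite gt_eqF// sqrtr_gt0.
have tt : Num.sqrt 2 ^+ 2 = 2 :> R by rewrite sqr_sqrtr.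
rewrite le_eqVlt; apply/orP; left; apply/eqP.
transitivity (2 * c / (Num.sqrt pi * Num.sqrt 2 * Num.sqrt (D c))).
  by field; rewrite ?p0 ?t0 ?S0.
rewrite -{1}tt /c; field.
by rewrite ?p0 ?t0 ?S0 ?normr_eq0 ?s0.
Qed.

End small_ball.

(** * Combinations of Gaussian variables *)

Lemma measurable_sum_seq (d : measure_display) (T : measurableType d)
    (R : realType) (I : eqType) (s : seq I) (h : I -> T -> R) :
  (forall i, i \in s -> measurable_fun setT (h i)) ->
  measurable_fun setT (fun t => \sum_(i <- s) h i t).
Proof.
elim: s => [|i s IH] mh; first by under eq_fun do rewrite big_nil; exact: measurable_cst.
under eq_fun do rewrite big_cons.
apply: measurable_funD; first by apply: mh; rewrite inE eqxx.
by apply: IH => j js; apply: mh; rewrite inE js orbT.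
Qed.

Section quadratic_gauss.
Context {R : realType}.

(** The Gaussian integral of a quadratic polynomial in [x], by completing the
    square.  The constant term left over is the original one minus a multiple
    of [b ^+ 2]: for a quadratic form in several variables, of which [x] is one
    and [b] is linear in the others, this is the Schur complement. *)
Lemma integral_gauss_quadratic (k c b q : R) : 0 < 1 + k * c ->
  (\int[normal_prob 0 1]_x (expR (- (k / 2) * (q + 2 * x * b + c * x ^+ 2)))%:E =
   ((Num.sqrt (1 + k * c))^-1 *
      expR (- (k / 2) * (q - k * b ^+ 2 / (1 + k * c))))%:E)%E.
Proof.
move=> kc0; set S := Num.sqrt _.
have S_gt0 : 0 < S by rewrite sqrtr_gt0.
have S0 : S != 0 by rewrite gt_eqF.
have SS : 1 + k * c = S ^+ 2 by rewrite sqr_sqrtr// ltW.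
have pi0 : Num.sqrt (pi *+ 2) != 0 :> R.
  by rewrite gt_eqF// sqrtr_gt0 mulrn_wgt0// pi_gt0.
rewrite ge0_integral_normal_prob; last 2 first.
- apply/measurable_EFinP; apply: measurableT_comp => //.
  apply: measurable_funM => //; apply: measurable_funD.
    by apply: measurable_funD => //; do 2 apply: measurable_funM => //.
  by apply: measurable_funM => //; exact: measurable_funX.
- by move=> x; rewrite lee_fin expR_ge0.
set K := S^-1 * expR _.
rewrite (eq_integral (fun x : measurableTypeR R =>
    (K%:E * (normal_pdf (- (k * b) / S ^+ 2) S^-1 x)%:E)%E)).
  rewrite ge0_integralZl//.
  - by rewrite integral_normal_pdf mule1.
  - by apply/measurable_EFinP; exact: measurable_normal_pdf.
  - by move=> x _; rewrite lee_fin normal_pdf_ge0.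
  - by rewrite lee_fin mulr_ge0 ?expR_ge0// invr_ge0 ltW.
move=> x _; rewrite -!EFinM; congr (_%:E).
rewrite !normal_pdfE ?oner_neq0 ?invr_neq0// !normal_peakE /normal_fun /K.
rewrite normr1 normfV (gtr0_norm S_gt0) mul1r mulrCA -expRD mulrACA -expRD.
congr (_ * expR _); first by field; rewrite ?pi0 ?S0.
have kcE : k * c = S ^+ 2 - 1 by rewrite -SS; ring.
rewrite SS.
transitivity (- (k / 2) * (q + 2 * x * b) - (k * c) * x ^+ 2 / 2 - x ^+ 2 / 2).
  by field.
by rewrite kcE; field.
Qed.

End quadratic_gauss.

Section gaussian_family.
Context (d : measure_display) (T : measurableType d) (R : realType).
Context (P : probability T R) (I : finType) (X : I -> {RV P >-> R}).
Hypothesis indX : mutually_independent X.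
Hypothesis normX : forall i, standard_normal (X i).

Notation Xsigma J := (g_sigma_algebraType (cylinders X J)).

Lemma measurable_XsigmaS (J K : {set I}) (f : T -> R) : (J \subset K)%SET ->
  measurable_fun setT (f : Xsigma J -> R) ->
  measurable_fun setT (f : Xsigma K -> R).
Proof.
move=> /fintype.subsetP JK mf _ B mB; rewrite setTI.
have := mf measurableT B mB; rewrite setTI => mfB.
apply: (smallest_sub _ _ mfB); first exact: smallest_sigma_algebra.
move=> _ [E mE <-]; apply: sub_sigma_algebra.
exists (fun i => if i \in J then E i else setT); first by move=> i; case: ifP.
apply/seteqP; split => [t Et i iJ|t Et i _ /=].
  by have := Et i (JK _ iJ); rewrite /= (_ : i \in J).
by case: ifPn => // iJ; exact: Et.
Qed.

(** The coefficients are random but independent of the [X i] involved, so the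
    combination is a centred normal with a random variance.  The auxiliary
    noise [r t * x] makes the induction go through: eliminating [X k] merges
    its contribution into the variance of that noise, which is again a function
    of the variables of [J]. *)
Lemma integral_gaussian_combination_aux (J : {set I}) (s : seq I)
    (a : I -> T -> R) (r : T -> R) (f : measurableTypeR R -> \bar R) :
  uniq s -> (forall i, i \in s -> i \notin J) ->
  (forall i, measurable_fun setT (a i : Xsigma J -> R)) ->
  measurable_fun setT (r : Xsigma J -> R) ->
  measurable_fun setT f -> (forall x, 0 <= f x)%E ->
  (\int[P]_t \int[normal_prob 0 1]_x
     f (\sum_(i <- s) a i t * X i t + r t * x)%R =
   \int[P]_t \int[normal_prob 0 1]_x
     f (Num.sqrt (\sum_(i <- s) a i t ^+ 2 + r t ^+ 2) * x)%R)%E.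
Proof.
move=> us sJ ma mr mf f0; elim: s r us sJ mr => [|k s IH] r us sJ mr.
  apply: eq_integral => t _; under eq_integral do rewrite big_nil add0r.
  under [RHS]eq_integral do rewrite big_nil add0r -[X in f X]add0r.
  have := ge0_integral_gauss_convolution 0 0 (r t) mf f0.
  rewrite expr0n/= add0r => <-.
  under [RHS]eq_integral do under eq_integral do rewrite mul0r addr0 add0r.
  by rewrite [RHS]integral_cst//= probability_setT mule1.
have /andP[ks us'] := us; have sJ' i : i \in s -> i \notin J.
  by move=> si; apply: sJ; rewrite inE si orbT.
pose K := (J :|: [set i in s])%SET.
have JK : (J \subset K)%SET by exact: finset.subsetUl.
have kK : k \notin K by rewrite !inE negb_or ks sJ// inE eqxx.
pose C t := \sum_(i <- s) a i t * X i t.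
have mC : measurable_fun setT (C : Xsigma K -> R).
  apply: measurable_sum_seq => i si; apply: measurable_funM.
    exact: measurable_XsigmaS JK _.
  by apply: measurable_Xsigma; rewrite !inE si orbT.
have mak : measurable_fun setT (a k : Xsigma K -> R).
  exact: measurable_XsigmaS JK _.
have mrK : measurable_fun setT (r : Xsigma K -> R).
  exact: measurable_XsigmaS JK _.
pose F (z : Xsigma K * measurableTypeR R) :=
  (\int[normal_prob 0 1]_x f (C z.1 + a k z.1 * z.2 + r z.1 * x)%R)%E.
transitivity (\int[P]_t F (t, X k t))%E.
  apply: eq_integral => t _; apply: eq_integral => x _ /=.
  by congr f; rewrite big_cons /C; ring.
rewrite (integral_peel indX normX (F := F) kK); last 2 first.
- have mfst (g : T -> R) : measurable_fun setT (g : Xsigma K -> R) ->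
      measurable_fun setT
        (fun w : Xsigma K * measurableTypeR R * measurableTypeR R => g w.1.1).
    move=> mg; apply: (measurableT_comp mg).
    exact: (measurableT_comp (@measurable_fst _ _ _ _) (@measurable_fst _ _ _ _)).
  pose G (w : Xsigma K * measurableTypeR R * measurableTypeR R) :=
    f (C w.1.1 + a k w.1.1 * w.1.2 + r w.1.1 * w.2).
  apply: (measurable_fun_fubini_tonelli_F (m2 := normal_prob 0 1) G); last first.
    by move=> w; exact: f0.
  apply: (measurableT_comp mf); apply: measurable_funD.
    apply: measurable_funD; first exact: mfst.
    apply: measurable_funM; first exact: mfst.
    exact: (measurableT_comp (@measurable_snd _ _ _ _) (@measurable_fst _ _ _ _)).
  by apply: measurable_funM; [exact: mfst|exact: measurable_snd].
- by move=> z; apply: integral_ge0.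
transitivity (\int[P]_t \int[normal_prob 0 1]_x
    f (C t + Num.sqrt (a k t ^+ 2 + r t ^+ 2) * x)%R)%E.
  apply: eq_integral => t _.
  by rewrite -(ge0_integral_gauss_convolution (C t) (a k t) (r t) mf f0).
have mr' : measurable_fun setT
    ((fun t => Num.sqrt (a k t ^+ 2 + r t ^+ 2)) : Xsigma J -> R).
  apply: (measurableT_comp (continuous_measurable_fun (@sqrt_continuous R))).
  by apply: measurable_funD; apply: measurable_funX.
have E := IH _ us' sJ' mr'.
rewrite /C E; apply: eq_integral => t _.
rewrite big_cons sqr_sqrtr ?addr_ge0 ?sqr_ge0//.
by rewrite addrA [X in X + r t ^+ 2]addrC.
Qed.

Lemma integral_gaussian_combination (J : {set I}) (s : seq I)
    (a : I -> T -> R) (f : measurableTypeR R -> \bar R) :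
  uniq s -> (forall i, i \in s -> i \notin J) ->
  (forall i, measurable_fun setT (a i : Xsigma J -> R)) ->
  measurable_fun setT f -> (forall x, 0 <= f x)%E ->
  (\int[P]_t f (\sum_(i <- s) a i t * X i t)%R =
   \int[P]_t \int[normal_prob 0 1]_x
     f (Num.sqrt (\sum_(i <- s) a i t ^+ 2) * x)%R)%E.
Proof.
move=> us sJ ma mf f0.
have E := @integral_gaussian_combination_aux J s a (fun=> 0) f us sJ ma
  (@measurable_cst _ _ _ _ _ _) mf f0.
transitivity (\int[P]_t \int[normal_prob 0 1]_x
     f (\sum_(i <- s) a i t * X i t + 0 * x)%R)%E.
  apply: eq_integral => t _.
  under [RHS]eq_integral do rewrite mul0r addr0.
  by rewrite [RHS]integral_cst//= probability_setT mule1.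
rewrite E; apply: eq_integral => t _; apply: eq_integral => x _.
by rewrite expr0n addr0.
Qed.

End gaussian_family.

(** * The Laplace transform of a Gaussian quadratic form *)

Section quadratic_form.
Context {R : realType}.

Lemma discriminant_le (p b c : R) : 0 <= c ->
  (forall y, 0 <= p + 2 * y * b + c * y ^+ 2) -> b ^+ 2 <= c * p.
Proof.
rewrite le_eqVlt => /predU1P[<-|c0] H.
  rewrite mul0r; have [->|b0] := eqVneq b 0; first by rewrite expr0n.
  (* where the affine function [p + 2 * y * b] takes the value [-1] *)
  have := H (- (p + 1) / (2 * b)); rewrite mul0r addr0.
  by rewrite (_ : _ + _ = -1) ?oppr_ge0 ?ler10//; field.
have := H (- b / c).
rewrite (_ : _ + _ = (c * p - b ^+ 2) / c); last by field; rewrite gt_eqF.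
by rewrite pmulr_lge0 ?invr_gt0// subr_ge0.
Qed.

Definition quad_form (I : Type) (s : seq I) (S : I -> I -> R) (x : I -> R) : R :=
  \sum_(i <- s) \sum_(j <- s) S i j * x i * x j.

Definition trace_on (I : Type) (s : seq I) (S : I -> I -> R) : R := \sum_(i <- s) S i i.

Lemma quad_form_gram (I J : finType) (s : seq I) (g : I -> J -> R) x :
  quad_form s (fun i j => \sum_l g i l * g j l) x =
  \sum_l (\sum_(i <- s) g i l * x i) ^+ 2.
Proof.
under [RHS]eq_bigr do rewrite expr2 mulr_suml.
rewrite exchange_big/=; apply: eq_bigr => i _.
under [RHS]eq_bigr do rewrite mulr_sumr.
rewrite exchange_big/=; apply: eq_bigr => j _.
by rewrite -mulrA mulr_suml; apply: eq_bigr => l _; ring.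
Qed.

(** The diagonal entries are the values of the form at the basis vectors. *)
Lemma trace_on_ge0 (I : eqType) (s : seq I) (S : I -> I -> R) : uniq s ->
  (forall x, 0 <= quad_form s S x) -> 0 <= trace_on s S.
Proof.
move=> us psdS; rewrite /trace_on big_seq; apply: sumr_ge0 => i si.
have := psdS (fun j => (j == i)%:R).
have sum1 (G : I -> R) : \sum_(j <- s) G j * (j == i)%:R = G i.
  rewrite (bigD1_seq i)//= eqxx mulr1 big1 ?addr0// => j /negbTE ->.
  by rewrite mulr0.
rewrite /quad_form; under eq_bigr do rewrite sum1.
by rewrite sum1.
Qed.

(** The Schur complement of the entry [1 + k * S o o] of [1 + k S], transported
    back to the form [S]: the form that remains when the Gaussian variable [o]
    is integrated out of [exp (- k S / 2)]. *)
Definition schur (I : Type) (k : R) (o : I) (S : I -> I -> R) (i j : I) : R :=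
  S i j - k / (1 + k * S o o) * (S o i * S o j).

Section schur_complement.
Variables (I : eqType) (k : R) (o : I) (s : seq I) (S : I -> I -> R).
Hypothesis os : o \notin s.
Hypothesis symS : forall i j, S i j = S j i.
Hypothesis psdS : forall x, 0 <= quad_form (o :: s) S x.
Let b (x : I -> R) := \sum_(i <- s) S o i * x i.

Lemma quad_form_cons x : quad_form (o :: s) S x =
  quad_form s S x + 2 * x o * b x + S o o * x o ^+ 2.
Proof.
rewrite /quad_form big_cons big_cons.
under [X in _ + X]eq_bigr do rewrite big_cons.
rewrite big_split/= /b.
have -> : \sum_(i <- s) S i o * x i * x o = x o * \sum_(i <- s) S o i * x i.
  by rewrite mulr_sumr; apply: eq_bigr => i _; rewrite (symS i o); ring.
have -> : \sum_(j <- s) S o j * x o * x j = x o * \sum_(i <- s) S o i * x i.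
  by rewrite mulr_sumr; apply: eq_bigr => i _; ring.
ring.
Qed.

Lemma quad_form_schur x : quad_form s (schur k o S) x =
  quad_form s S x - k * b x ^+ 2 / (1 + k * S o o).
Proof.
rewrite /quad_form /schur.
have -> : k * b x ^+ 2 / (1 + k * S o o) =
    \sum_(i <- s) \sum_(j <- s) k / (1 + k * S o o) * (S o i * S o j) * x i * x j.
  rewrite expr2 /b mulrAC mulr_suml mulr_sumr; apply: eq_bigr => i _.
  rewrite mulr_sumr mulr_sumr; apply: eq_bigr => j _; ring.
rewrite -sumrB; apply: eq_bigr => i _; rewrite -sumrB; apply: eq_bigr => j _; ring.
Qed.

Lemma quad_form_subst x y :
  0 <= quad_form s S x + 2 * y * b x + S o o * y ^+ 2.
Proof.
have := psdS (fun i => if i == o then y else x i).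
rewrite quad_form_cons eqxx.
have xs i : i \in s -> (if i == o then y else x i) = x i.
  by case: eqP => // ->; rewrite (negbTE os).
rewrite /b (eq_big_seq (fun i => S o i * x i)); last by move=> i /xs ->.
rewrite /quad_form (eq_big_seq (fun i => \sum_(j <- s) S i j * x i * x j))//.
move=> i /xs ->; apply: eq_big_seq => j /xs -> //.
Qed.

Lemma diag_ge0 : 0 <= S o o.
Proof.
have := quad_form_subst (fun=> 0) 1.
rewrite /b /quad_form !big1 ?mulr0 ?add0r ?expr1n ?mulr1// => i _; last first.
  by rewrite big1// => j _; rewrite !mulr0.
by rewrite mulr0.
Qed.

(** For [k <= 0] a nonnegative square is added.  For [k > 0] the complement
    exceeds the value of the full form at the point whose coordinate [o] is
    the critical point of the completed square. *)
Lemma schur_psd x : 0 < 1 + k * S o o -> 0 <= quad_form s (schur k o S) x.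
Proof.
move=> kc; rewrite quad_form_schur.
have [k0|k0] := leP k 0.
  have := quad_form_subst x 0; rewrite mulr0 mul0r addr0 expr0n mulr0 addr0.
  move=> q0; rewrite subr_ge0 (le_trans _ q0)//.
  by rewrite mulr_le0_ge0 ?invr_ge0 ?(ltW kc)// mulr_le0_ge0 ?sqr_ge0.
have c0 := diag_ge0; set c := S o o in kc c0 *.
have := quad_form_subst x (- k * b x / (1 + k * c)); rewrite -/c.
rewrite (_ : quad_form s S x + _ + _ = quad_form s S x - k * b x ^+ 2 / (1 + k * c)
    - k * b x ^+ 2 / (1 + k * c) ^+ 2); last by field; rewrite gt_eqF.
move=> q0; apply: (le_trans q0); rewrite gerBl.
by rewrite divr_ge0 ?sqr_ge0// mulr_ge0 ?sqr_ge0// ltW.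
Qed.

Lemma psd_offdiag i : uniq s -> i \in s -> S o i ^+ 2 <= S o o * S i i.
Proof.
move=> us si; apply: discriminant_le => [|y]; first exact: diag_ge0.
have := quad_form_subst (fun j => (j == i)%:R) y.
have sum1 (G : I -> R) : \sum_(j <- s) G j * (j == i)%:R = G i.
  rewrite (bigD1_seq i)//= eqxx mulr1 big1 ?addr0// => j /negbTE ->.
  by rewrite mulr0.
rewrite /quad_form /b.
under eq_bigr do rewrite sum1.
by rewrite !sum1.
Qed.

(** The one-variable case of [1 + k \sum a_i <= \prod (1 + k a_i)].  The two
    sides differ by [k ^+ 2] times [S o o * tr S - \sum_i S o i ^+ 2], the traces
    being over the remaining indices, and this is nonnegative because every
    two by two minor of a positive semidefinite form is. *)
Lemma schur_trace : uniq s -> 0 < 1 + k * S o o ->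
  1 + k * trace_on (o :: s) S <=
  (1 + k * S o o) * (1 + k * trace_on s (schur k o S)).
Proof.
move=> us kc; rewrite /trace_on big_cons.
have -> : \sum_(i <- s) schur k o S i i =
    \sum_(i <- s) S i i - k / (1 + k * S o o) * \sum_(i <- s) S o i ^+ 2.
  by rewrite mulr_sumr -sumrB; apply: eq_bigr => i _; rewrite /schur expr2.
have H : \sum_(i <- s) S o i ^+ 2 <= S o o * \sum_(i <- s) S i i.
  rewrite mulr_sumr big_seq [leRHS]big_seq; apply: ler_sum => i.
  exact: psd_offdiag.
rewrite -subr_ge0.
rewrite (_ : _ - _ = k ^+ 2 * (S o o * \sum_(i <- s) S i i - \sum_(i <- s) S o i ^+ 2)).
  by rewrite mulr_ge0 ?sqr_ge0// subr_ge0.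
by field; rewrite gt_eqF.
Qed.

End schur_complement.

End quadratic_form.

Section gaussian_quadratic_form.
Context (d : measure_display) (T : measurableType d) (R : realType).
Context (P : probability T R) (I : finType) (X : I -> {RV P >-> R}).
Hypothesis indX : mutually_independent X.
Hypothesis normX : forall i, standard_normal (X i).

Notation Xsigma J := (g_sigma_algebraType (cylinders X J)).

Lemma measurable_quad_form (J : {set I}) (s : seq I) (S : I -> I -> R) :
  (forall i, i \in s -> i \in J) ->
  measurable_fun setT
    ((fun t => quad_form s S (fun i => X i t)) : Xsigma J -> R).
Proof.
move=> sJ; rewrite /quad_form.
apply: measurable_sum_seq => i si; apply: measurable_sum_seq => j sj.
by apply: measurable_funM; [apply: measurable_funM => //|];
  apply: measurable_Xsigma; exact: sJ.
Qed.

(** By induction on the number of variables: integrating out one of them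
    produces the factor [(1 + k * S o o) ^ (-1/2)] and replaces the form by its
    Schur complement, and [schur_trace] recombines the two factors. *)
Lemma gaussian_quadratic_form_le (s : seq I) (S : I -> I -> R) (k : R) :
  uniq s -> (forall i j, S i j = S j i) -> (forall x, 0 <= quad_form s S x) ->
  0 < 1 + k * trace_on s S ->
  (\int[P]_t (expR (- (k / 2) * quad_form s S (fun i => X i t)))%:E <=
   ((Num.sqrt (1 + k * trace_on s S))^-1)%:E)%E.
Proof.
elim: s S => [|o s IH] S us symS psdS ktr.
  rewrite /trace_on big_nil mulr0 addr0 sqrtr1 invr1.
  under eq_integral do rewrite /quad_form big_nil mulr0 expR0.
  by rewrite integral_cst//= probability_setT mule1.
have /andP[os us'] := us.
have c0 := diag_ge0 os symS psdS.
have tr0 : 0 <= trace_on s S.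
  apply: trace_on_ge0 => // x; have := quad_form_subst os symS psdS x 0.
  by rewrite mulr0 mul0r addr0 expr0n mulr0 addr0.
(* no diagonal entry exceeds the trace, which matters for negative [k] *)
have kc : 0 < 1 + k * S o o.
  have [k0|k0] := leP 0 k; first by rewrite ltr_pwDl// mulr_ge0.
  rewrite (lt_le_trans ktr)// lerD2l ler_wnM2l ?(ltW k0)//.
  by rewrite /trace_on big_cons lerDl.
pose J := [set i in s]%SET.
have oJ : o \notin J by rewrite inE.
have mq := @measurable_quad_form J s.
pose F (z : Xsigma J * measurableTypeR R) :=
  (expR (- (k / 2) * (quad_form s S (fun i => X i z.1) +
     2 * z.2 * (\sum_(i <- s) S o i * X i z.1) + S o o * z.2 ^+ 2)))%:E.
have -> : (\int[P]_t (expR (- (k / 2) * quad_form (o :: s) S (fun i => X i t)))%:E =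
    \int[P]_t F (t, X o t))%E.
  by apply: eq_integral => t _; rewrite quad_form_cons.
rewrite (integral_peel indX normX (F := F) oJ); last 2 first.
- have mfst (g : T -> R) : measurable_fun setT (g : Xsigma J -> R) ->
      measurable_fun setT (fun w : Xsigma J * measurableTypeR R => g w.1).
    by move=> mg; apply: (measurableT_comp mg); exact: measurable_fst.
  have msnd : measurable_fun setT (fun w : Xsigma J * measurableTypeR R => w.2 : R).
    exact: measurable_snd.
  apply/measurable_EFinP; apply: measurableT_comp => //.
  apply: measurable_funM => //; apply: measurable_funD; last first.
    by apply: measurable_funM => //; exact: measurable_funX.
  apply: measurable_funD.
    apply: (mfst (fun t => quad_form s S (fun i => X i t))).
    by apply: mq => i; rewrite inE.
  apply: measurable_funM; first exact: measurable_funM.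
  apply: (mfst (fun t => \sum_(i <- s) S o i * X i t)).
  apply: measurable_sum_seq => i si; apply: measurable_funM => //.
  by apply: measurable_Xsigma; rewrite inE.
- by move=> z; rewrite lee_fin expR_ge0.
have -> : (\int[P]_t \int[normal_prob 0 1]_x F (t, x) =
    \int[P]_t ((Num.sqrt (1 + k * S o o))^-1%:E *
      (expR (- (k / 2) * quad_form s (schur k o S) (fun i => X i t)))%:E))%E.
  apply: eq_integral => t _; rewrite -EFinM quad_form_schur//.
  by rewrite -(integral_gauss_quadratic _ _ kc).
rewrite ge0_integralZl//; last first.
  apply/measurable_EFinP; apply: measurableT_comp => //.
  apply: measurable_funM => //; apply: (measurable_of_Xsigma (J := J)).
  by apply: mq => i; rewrite inE.
have trS := schur_trace os symS psdS us' kc.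
have ktr' : 0 < 1 + k * trace_on s (schur k o S).
  by rewrite -(pmulr_rgt0 _ kc) (lt_le_trans ktr).
apply: (@le_trans _ _ ((Num.sqrt (1 + k * S o o))^-1%:E *
    ((Num.sqrt (1 + k * trace_on s (schur k o S)))^-1)%:E)%E).
  rewrite lee_wpmul2l ?lee_fin ?invr_ge0 ?sqrtr_ge0//; apply: IH => //.
    by move=> i j; rewrite /schur symS [S o i * _]mulrC.
  by move=> x; exact: schur_psd.
rewrite -EFinM lee_fin -invfM -sqrtrM ?(ltW kc)// lef_pV2 ?posrE ?sqrtr_gt0 ?mulr_gt0//.
by rewrite ler_wsqrtr.
Qed.

End gaussian_quadratic_form.

(** * A logarithmic integral with Gaussian damping *)

Section truncated_log_integral.
Context {R : realType}.
Local Notation mu := (@lebesgue_measure R).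
Variable tau : R.
Hypothesis tau1 : 1 < tau.

Let w (x : R) := expR (- (x ^+ 2 / (6 * tau ^+ 2))) / Num.sqrt (1 + x ^+ 2).

Let tau0 : 0 < tau. Proof. by rewrite (lt_trans _ tau1). Qed.

Let S_gt0 (x : R) : 0 < Num.sqrt (1 + x ^+ 2).
Proof. by rewrite sqrtr_gt0 ltr_pwDl// sqr_ge0. Qed.

Let w_ge0 x : 0 <= w x.
Proof. by rewrite divr_ge0 ?expR_ge0// ltW. Qed.

Lemma continuous_damped : continuous w.
Proof.
move=> x; apply: cvgM.
  apply: (cvg_comp (fun x => - (x ^+ 2 / (6 * tau ^+ 2))) expR); last first.
    exact: continuous_expR.
  apply: cvgN; apply: cvgM; [exact: exprn_continuous|exact: cvg_cst].
apply: cvgV; first by rewrite gt_eqF.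
apply: (cvg_comp (fun x => 1 + x ^+ 2) Num.sqrt); last exact: sqrt_continuous.
by apply: cvgD; [exact: cvg_cst|exact: exprn_continuous].
Qed.

Let mw D : measurable_fun D (EFin \o w).
Proof.
apply: measurable_funTS; apply/measurable_EFinP.
exact: continuous_measurable_fun continuous_damped.
Qed.

Let damping_le1 (x : R) : expR (- (x ^+ 2 / (6 * tau ^+ 2))) <= 1.
Proof. by rewrite expR_le1 oppr_le0 divr_ge0 ?sqr_ge0// mulr_ge0 ?sqr_ge0. Qed.

Let near0 : (\int[mu]_(x in `[0%R, 1%R[) (w x)%:E <= 1)%E.
Proof.
apply: (@le_trans _ _ (\int[mu]_(x in `[0%R, 1%R[) (cst 1%E x))%E).
  apply: ge0_le_integral => //; first by move=> x _; rewrite lee_fin.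
    exact: mw.
  move=> x _; rewrite lee_fin ler_pdivrMr// mul1r (le_trans (damping_le1 x))//.
  by rewrite -[leLHS]sqrtr1 ler_wsqrtr// lerDl sqr_ge0.
by rewrite integral_cst//= lebesgue_measure_itv/= lte_fin ltr01 oppr0 adde0 mul1e.
Qed.

Let sqrt_ge (x : R) : 0 < x -> x <= Num.sqrt (1 + x ^+ 2).
Proof.
by move=> x0; rewrite -{1}(gtr0_norm x0) -sqrtr_sqr ler_wsqrtr// lerDr.
Qed.

Let middle : (\int[mu]_(x in `[1%R, (2 * tau)%R[) (w x)%:E <= (ln (2 * tau))%:E)%E.
Proof.
apply: (@le_trans _ _ (\int[mu]_(x in `[1%R, (2 * tau)%R]) (x^-1)%:E)%E).
  rewrite integral_itv_bndo_bndc//.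
  apply: ge0_le_integral => //; first by move=> x _; rewrite lee_fin.
  - exact: mw.
  - apply/measurable_EFinP; apply: subspace_continuous_measurable_fun => //.
    apply: continuous_in_subspaceT => x; rewrite inE/= in_itv/= => /andP[x1 _].
    by apply: inv_continuous; rewrite gt_eqF// (lt_le_trans _ x1).
  move=> x; rewrite /= in_itv/= => /andP[x1 _].
  have x0 : 0 < x by rewrite (lt_le_trans _ x1).
  rewrite lee_fin -[leRHS]mul1r ler_pM ?expR_ge0 ?invr_ge0 ?(ltW (S_gt0 x))//.
  by rewrite lef_pV2 ?posrE// sqrt_ge.
have dln (x : R) : 1 <= x <= 2 * tau -> is_derive x 1 (@ln R) x^-1.
  by move=> /andP[x1 _]; apply: is_derive1_ln; rewrite (lt_le_trans _ x1).
rewrite (integral_is_derive _ dln).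
- by rewrite ln1 subr0.
- by rewrite mulr_natl mulr2n ltr_pwDl// ltW.
- move=> x /andP[x1 _]; apply: inv_continuous; rewrite gt_eqF//.
  by rewrite (lt_le_trans _ x1).
Qed.

Let tail : (\int[mu]_(x in `[(2 * tau)%R, +oo[) (w x)%:E <= 1)%E.
Proof.
have t20 : 0 < 2 * tau by rewrite mulr_gt0.
have x_gt0 x : 2 * tau <= x -> 0 < x by exact: lt_le_trans.
pose f x : R := 6 * tau ^+ 2 * (x ^+ 3)^-1.
pose F x : R := - 3 * tau ^+ 2 * (x ^+ 2)^-1.
have cf x : 0 < x -> {for x, continuous f}.
  move=> x0; apply: cvgM; first exact: cvg_cst.
  by apply: cvgV; [rewrite gt_eqF// exprn_gt0|exact: exprn_continuous].
have dF (x : R) : 0 < x -> is_derive x 1 F (f x).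
  move=> x0; have x20 : x ^+ 2 != 0 by rewrite gt_eqF// exprn_gt0.
  have dV : is_derive x 1 (fun x : R => (x ^+ 2)^-1) (- (x ^+ 2) ^- 2 *: (2 * x)).
    apply: is_deriveV => //; apply: is_derive_eq.
    by rewrite /GRing.scale/=; ring.
  apply: is_derive_eq; rewrite /GRing.scale/= /f; field.
  by rewrite gt_eqF.
apply: (@le_trans _ _ (\int[mu]_(x in `[(2 * tau)%R, +oo[) (f x)%:E)%E).
  apply: ge0_le_integral => //; first by move=> x _; rewrite lee_fin.
  - exact: mw.
  - apply/measurable_EFinP; apply: subspace_continuous_measurable_fun => //.
    apply: continuous_in_subspaceT => x; rewrite inE/= in_itv/= andbT => /x_gt0.
    exact: cf.
  move=> x; rewrite /= in_itv/= andbT => /x_gt0 x0.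
  have -> : f x = (x ^+ 2 / (6 * tau ^+ 2))^-1 * x^-1.
    by rewrite /f; field; rewrite !gt_eqF.
  rewrite lee_fin ler_pM ?expR_ge0 ?invr_ge0 ?(ltW (S_gt0 x))//.
    rewrite expRN lef_pV2 ?posrE ?expR_gt0//.
      by rewrite (le_trans _ (expR_ge1Dx _))// lerDr.
    by rewrite divr_gt0 ?exprn_gt0// mulr_gt0 ?exprn_gt0.
  by rewrite lef_pV2 ?posrE// sqrt_ge.
rewrite (@ge0_continuous_FTC2y _ f F (2 * tau) 0).
- rewrite sub0e -EFinN lee_fin /F.
  rewrite (_ : - _ = 3 / 4); last by field; rewrite gt_eqF.
  by lra.
- move=> x /x_gt0 x0.
  by rewrite /f !mulr_ge0 ?invr_ge0 ?exprn_ge0 ?(ltW x0) ?(ltW tau0).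
- apply: continuous_in_subspaceT => x; rewrite inE/= in_itv/= andbT => /x_gt0.
  exact: cf.
- rewrite -[X in _ --> X](mulr0 (- 3 * tau ^+ 2)); apply: cvgM; first exact: cvg_cst.
  apply/gtr0_cvgV0; last exact: cvgr_expr2.
  by near=> x; rewrite exprn_gt0//; near: x; exact: nbhs_pinfty_gt.
- by move=> x /ltW/x_gt0 x0; have [] := dF x x0.
- apply: cvg_at_right_filter; apply: differentiable_continuous.
  by apply/derivable1_diffP; have [] := dF _ t20.
- move=> x; rewrite in_itv/= andbT => /ltW/x_gt0 x0.
  by rewrite derive1E; apply: derive_val; exact: dF.
Unshelve. all: by end_near. Qed.

(** By symmetry it is enough to integrate over the half-line, cut at [1] and at
    [2 * tau].  The integrand is at most [1] on the first piece, at most [x^-1]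
    on the second, and at most [6 * tau ^+ 2 / x ^+ 3] on the third, because
    [exp (- y) <= y^-1].  The three contributions are at most [1],
    [ln (2 * tau)] and [3 / 4]. *)
Lemma damped_integral_le :
  (\int[mu]_x (expR (- (x ^+ 2 / (6 * tau ^+ 2))) / Num.sqrt (1 + x ^+ 2))%:E <=
   (2 * (2 + ln (2 * tau)))%:E)%E.
Proof.
rewrite (@ge0_symfun_integralT _ w)//; last 2 first.
- exact: continuous_damped.
- by move=> x; rewrite /w /= sqrrN.
rewrite EFinM lee_wpmul2l//.
rewrite -set_itvcy.
have t12 : 1 < 2 * tau by rewrite mulr_natl mulr2n ltr_pwDl// ltW.
have -> : [set` `[0%R, +oo[%R] =
    [set` `[0%R, 1%R[%R] `|`
    ([set` `[1%R, (2 * tau)%R[%R] `|` [set` `[(2 * tau)%R, +oo[%R]) :> set R.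
  apply/seteqP; split => x /=; rewrite !in_itv/= !andbT.
    move=> x0; have [x1|x1] := ltP x 1; first by left; rewrite x0.
    by right; have [x2|x2] := ltP x (2 * tau); [left|right].
  move=> [/andP[]//|[/andP[x1 _]|x2]]; first by rewrite (le_trans _ x1).
  by rewrite (le_trans _ x2)// mulr_ge0// ltW.
have mm : measurable
    ([set` `[1%R, (2 * tau)%R[%R] `|` [set` `[(2 * tau)%R, +oo[%R] : set R).
  exact: measurableU.
rewrite (@ge0_integral_setU _ _ _ mu [set` `[0%R, 1%R[%R] _ _ mm (EFin \o w))//;
  last 3 first.
- exact: mw.
- by move=> x _; rewrite lee_fin.
- apply/disj_set2P; apply/seteqP; split => // x /=; rewrite !in_itv/= !andbT.
  move=> [/andP[_ x1] [/andP[]|x2]]; first by rewrite leNgt x1.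
  by move: (lt_trans x1 t12); rewrite ltNge x2.
rewrite (@ge0_integral_setU _ _ _ mu [set` `[1%R, (2 * tau)%R[%R]
  [set` `[(2 * tau)%R, +oo[%R] _ _ (EFin \o w))//; last 3 first.
- exact: mw.
- by move=> x _; rewrite lee_fin.
- apply/disj_set2P; apply/seteqP; split => // x /=; rewrite !in_itv/= !andbT.
  by move=> [/andP[_]]; rewrite ltNge => /negP.
apply: (@le_trans _ _ (1%:E + ((ln (2 * tau))%:E + 1%:E))%E).
  exact: leeD near0 (leeD middle tail).
by rewrite -!EFinD lee_fin; lra.
Qed.

End truncated_log_integral.

(** * Gaussian bilinear forms: small balls *)

Section bilinear_form.
Context (d : measure_display) (T : measurableType d) (R : realType).
Context (P : probability T R) (m n : nat).
Context (u : 'I_m -> {RV P >-> R}) (v : 'I_n -> {RV P >-> R}).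
Hypothesis uv : independent_gaussian_vectors u v.
Variable c : 'I_n -> 'I_m -> R.
Hypothesis c1 : \sum_j \sum_i c j i ^+ 2 = 1.
Local Notation mu := (@lebesgue_measure R).

Definition bilinear t : R := \sum_i (\sum_j c j i * v j t) * u i t.

(** The conditional variance of [bilinear] given [v]. *)
Definition bilinear_var t : R := \sum_i (\sum_j c j i * v j t) ^+ 2.

Let X (l : 'I_m + 'I_n) := match l with inl i => u i | inr j => v j end.

Let indX : mutually_independent X. Proof. by case: uv. Qed.

Let normX l : standard_normal (X l).
Proof. by case: uv => nu nv _; case: l. Qed.

(** [bilinear_var] is the quadratic form of a Gram matrix, in the family of all
   the variables; the rows indexed by the [u i] vanish. *)
Let cc (l : 'I_m + 'I_n) i : R := if l is inr j then c j i else 0.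

Let su : seq ('I_m + 'I_n) := [seq inl i | i <- enum 'I_m].
Let sv : seq ('I_m + 'I_n) := [seq inr i | i <- enum 'I_n].

Let uniq_su : uniq su.
Proof. by rewrite map_inj_uniq ?enum_uniq// => i j []. Qed.

Let uniq_sv : uniq sv.
Proof. by rewrite map_inj_uniq ?enum_uniq// => i j []. Qed.

Let sum_su (G : 'I_m + 'I_n -> R) : \sum_(l <- su) G l = \sum_i G (inl i).
Proof. by rewrite big_map big_enum. Qed.

Let sum_sv (G : 'I_m + 'I_n -> R) : \sum_(l <- sv) G l = \sum_j G (inr j).
Proof. by rewrite big_map big_enum. Qed.

Lemma integral_bilinear (f : measurableTypeR R -> \bar R) :
  measurable_fun setT f -> (forall x, 0 <= f x)%E ->
  (\int[P]_t f (bilinear t) =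
   \int[P]_t \int[normal_prob 0 1]_x f (Num.sqrt (bilinear_var t) * x)%R)%E.
Proof.
move=> mf f0; pose J : {set 'I_m + 'I_n} := [set l in sv]%SET.
pose a (l : 'I_m + 'I_n) t := if l is inl i then \sum_j c j i * v j t else 0.
have sJ l : l \in su -> l \notin J.
  by move=> /mapP[i _ ->]; rewrite inE; apply/mapP => -[j _].
have ma l : measurable_fun setT
    (a l : g_sigma_algebraType (cylinders X J) -> R).
  case: l => [i|j] /=; last exact: measurable_cst.
  apply: measurable_sum => j; apply: measurable_funM => //.
  apply: (@measurable_Xsigma _ _ _ _ _ X J (inr j)).
  by rewrite inE map_f// mem_enum.
have E := integral_gaussian_combination indX normX uniq_su sJ ma mf f0.
transitivity (\int[P]_t f (\sum_(l <- su) a l t * X l t)%R)%E.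
  by apply: eq_integral => t _; rewrite sum_su.
by rewrite E; apply: eq_integral => t _; rewrite sum_su.
Qed.

(** The trace of the Gram matrix is the squared Frobenius norm of [c]. *)
Lemma integral_bilinear_var_le (k : R) : 0 < 1 + k ->
  (\int[P]_t (expR (- (k / 2) * bilinear_var t))%:E <= ((Num.sqrt (1 + k))^-1)%:E)%E.
Proof.
move=> k0; pose S l l' := \sum_i cc l i * cc l' i.
have tr : trace_on sv S = 1.
  rewrite -c1 /trace_on sum_sv; apply: eq_bigr => j _.
  by apply: eq_bigr => i _; rewrite expr2.
have QE t : bilinear_var t = quad_form sv S (fun l => X l t).
  by rewrite quad_form_gram; apply: eq_bigr => i _; rewrite sum_sv.
under eq_integral do rewrite QE.
have := @gaussian_quadratic_form_le _ _ _ _ _ X indX normX sv S k uniq_sv.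
rewrite tr mulr1; apply => //.
  by move=> l l'; apply: eq_bigr => i _; rewrite mulrC.
by move=> x; rewrite quad_form_gram sumr_ge0// => i _; rewrite sqr_ge0.
Qed.

Lemma measurable_bilinear : measurable_fun setT bilinear.
Proof.
apply: measurable_sum => i; apply: measurable_funM => //.
by apply: measurable_sum => j; exact: measurable_funM.
Qed.

Lemma measurable_bilinear_var : measurable_fun setT bilinear_var.
Proof.
apply: measurable_sum => i; apply: measurable_funX.
by apply: measurable_sum => j; exact: measurable_funM.
Qed.

Lemma bilinear_var_ge0 t : 0 <= bilinear_var t.
Proof. by apply: sumr_ge0 => i _; exact: sqr_ge0. Qed.

(** Given [v], the moment generating function of a normal variable turns
    [exp (theta * bilinear)] into [exp (theta ^+ 2 * bilinear_var / 2)]. *)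
Lemma integral_expR_bilinear_le (theta : R) : theta ^+ 2 < 1 ->
  (\int[P]_t (expR (theta * bilinear t))%:E <=
   ((Num.sqrt (1 - theta ^+ 2))^-1)%:E)%E.
Proof.
move=> th1; pose f (x : measurableTypeR R) : \bar R := (expR (theta * x))%:E.
have mf : measurable_fun setT f.
  by apply/measurable_EFinP; apply: measurableT_comp => //; exact: measurable_funM.
have f0 x : (0 <= f x)%E by rewrite lee_fin expR_ge0.
rewrite (integral_bilinear mf f0) /f.
have -> : (\int[P]_t \int[normal_prob 0 1]_x
      (expR (theta * (Num.sqrt (bilinear_var t) * x)))%:E =
    \int[P]_t (expR (- (- theta ^+ 2 / 2) * bilinear_var t))%:E)%E.
  apply: eq_integral => t _.
  have k1 : 0 < 1 + 1 * 0 :> R by rewrite mulr0 addr0.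
  have E := integral_gauss_quadratic (- (theta * Num.sqrt (bilinear_var t))) 0 k1.
  rewrite (_ : expR (- (- theta ^+ 2 / 2) * bilinear_var t) =
    (Num.sqrt (1 + 1 * 0))^-1 * expR (- (1 / 2) *
      (0 - 1 * (- (theta * Num.sqrt (bilinear_var t))) ^+ 2 / (1 + 1 * 0)))); last first.
    rewrite mulr0 addr0 sqrtr1 invr1 mul1r; congr expR.
    by rewrite sqrrN exprMn (sqr_sqrtr (bilinear_var_ge0 t)); field.
  by rewrite -E; apply: eq_integral => x _; congr (expR _)%:E; field.
have k1' : 0 < 1 + - theta ^+ 2 by rewrite subr_gt0.
exact: integral_bilinear_var_le k1'.
Qed.

(** Up to a constant, [D ^ (-1/2)] is a mixture of exponentials in [D]. *)
Lemma integral_gauss_weight (D : R) : 0 < D ->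
  (\int[mu]_x (expR (- (x ^+ 2 / 2) * D))%:E = (Num.sqrt (2 * pi / D))%:E)%E.
Proof.
move=> D0; pose s := (Num.sqrt D)^-1.
have s0 : s != 0 by rewrite invr_neq0// gt_eqF// sqrtr_gt0.
have p0 := normal_peak_gt0 s0.
rewrite (eq_integral (fun x : measurableTypeR R =>
    (normal_peak s)^-1%:E * (normal_pdf 0 s x)%:E)%E); last first.
  move=> x _; rewrite -EFinM normal_pdfE//= mulKf ?gt_eqF//; congr (expR _)%:E.
  rewrite /s subr0 exprVn (sqr_sqrtr (ltW D0)); field.
  by rewrite gt_eqF.
rewrite ge0_integralZl//; last 3 first.
- by apply/measurable_EFinP; exact: measurable_normal_pdf.
- by move=> x _; rewrite lee_fin normal_pdf_ge0.
- by rewrite lee_fin invr_ge0 ltW.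
rewrite integral_normal_pdf mule1 normal_peakE invrK /s; congr (_%:E).
rewrite normfV ger0_norm ?sqrtr_ge0// -sqrtrV ?(ltW D0)// -sqrtrM ?invr_ge0 ?(ltW D0)//.
by congr Num.sqrt; field; rewrite gt_eqF.
Qed.

(** Given [v], bound the probability by [gauss_small_ball] and write the bound
    as a mixture of exponentials in the conditional variance; then exchange
    the mixture with the expectation over [v]. *)
Lemma bilinear_small_ball_integral (tau : R) : 0 < tau ->
  (P [set t | `|bilinear t| <= tau^-1]%R <= (tau^-1 / pi)%:E *
   \int[mu]_x (expR (- (x ^+ 2 / (6 * tau ^+ 2))) / Num.sqrt (1 + x ^+ 2))%:E)%E.
Proof.
move=> tau0; have pi0 := @pi_gt0 R; set e := tau^-1.
have e0 : 0 < e by rewrite invr_gt0.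
have mB : measurable [set t | `|bilinear t| <= e].
  rewrite (_ : [set t | _] = bilinear @^-1` [set` `[- e, e]]); last first.
    by apply/seteqP; split => t /=; rewrite in_itv/= ler_norml.
  by rewrite -[X in measurable X]setTI; apply: measurable_bilinear.
pose f (x : measurableTypeR R) : \bar R := (\1_[set x : R | (`|x| <= e)%R] x)%:E.
have mA : measurable [set x : R | `|x| <= e].
  rewrite (_ : [set x | _] = [set` `[- e, e]]); last first.
    by apply/seteqP; split => t /=; rewrite in_itv/= ler_norml.
  exact: measurable_itv.
have mf : measurable_fun setT f by apply/measurable_EFinP; exact: measurable_indic.
have f0 x : (0 <= f x)%E by rewrite lee_fin indicE.
pose G (w : T * measurableTypeR R) : \bar R :=
  (expR (- (w.2 ^+ 2 / 2) * (bilinear_var w.1 + e ^+ 2 / 3)))%:E.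
have mG : measurable_fun setT G.
  have mQ : measurable_fun setT (fun w : T * measurableTypeR R => bilinear_var w.1).
    by apply: (measurableT_comp measurable_bilinear_var); exact: measurable_fst.
  have msnd : measurable_fun setT (fun w : T * measurableTypeR R => w.2 : R).
    exact: measurable_snd.
  apply/measurable_EFinP; apply: measurableT_comp => //.
  apply: measurable_funM; last exact: measurable_funD.
  apply: measurableT_comp => //; apply: measurable_funM => //.
  exact: measurable_funX.
have G0 w : (0 <= G w)%E by rewrite lee_fin expR_ge0.
have -> : P [set t | `|bilinear t| <= e] = (\int[P]_t f (bilinear t))%E.
  by rewrite -[X in P X]setIT -integral_indic.
rewrite (integral_bilinear mf f0).
have mFG := measurable_fun_fubini_tonelli_F (m2 := mu) G mG G0.
apply: (@le_trans _ _ (\int[P]_t ((e / pi)%:E * \int[mu]_x G (t, x)))%E).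
  apply: ge0_le_integral => //.
  - by move=> t _; apply: integral_ge0.
  - pose H (w : T * measurableTypeR R) := f (Num.sqrt (bilinear_var w.1) * w.2).
    apply: (measurable_fun_fubini_tonelli_F (m2 := normal_prob 0 1) H) => [|w];
      last exact: f0.
    apply: (measurableT_comp mf); apply: measurable_funM; last exact: measurable_snd.
    apply: (measurableT_comp (continuous_measurable_fun (@sqrt_continuous R))).
    by apply: (measurableT_comp measurable_bilinear_var); exact: measurable_fst.
  - exact: emeasurable_funM.
  move=> t _.
  have D0 : 0 < bilinear_var t + e ^+ 2 / 3.
    by rewrite ltr_wpDl ?bilinear_var_ge0// divr_gt0 ?exprn_gt0.
  rewrite /G/= integral_gauss_weight// -EFinM.
  have -> : (\int[normal_prob 0 1]_x f (Num.sqrt (bilinear_var t) * x)%R =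
      normal_prob 0 1 [set x : R | (`|Num.sqrt (bilinear_var t) * x| <= e)%R])%E.
    rewrite -[X in normal_prob 0 1 X]setIT -integral_indic//.
    have msx : measurable_fun setT (fun x : R => Num.sqrt (bilinear_var t) * x).
      exact: measurable_funM.
    by rewrite -[X in measurable X]setTI; exact: (msx measurableT _ mA).
  apply: (le_trans (gauss_small_ball _ e0)).
  rewrite (sqr_sqrtr (bilinear_var_ge0 t)) lee_fin le_eqVlt; apply/orP; left.
  apply/eqP; rewrite !sqrtrM ?mulr_ge0 ?(ltW pi0)//.
  rewrite !sqrtrV ?(ltW pi0) ?(ltW D0)//.
  have pE : pi = Num.sqrt pi ^+ 2 :> R by rewrite sqr_sqrtr ?(ltW pi0).
  rewrite [in e / pi]pE; field.
  by rewrite !gt_eqF// sqrtr_gt0.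
rewrite ge0_integralZl//; last 2 first.
- by move=> t _; apply: integral_ge0.
- by rewrite lee_fin divr_ge0 ?(ltW e0) ?(ltW pi0).
rewrite lee_wpmul2l ?lee_fin ?divr_ge0 ?(ltW e0) ?(ltW pi0)//.
rewrite (fubini_tonelli (m1 := P) (m2 := mu) G mG)//.
apply: ge0_le_integral => //.
- by move=> x _; apply: integral_ge0.
- exact: (measurable_fun_fubini_tonelli_G (m1 := P) G mG G0).
- apply/measurable_EFinP; exact: continuous_measurable_fun (@continuous_damped R tau).
move=> x _.
rewrite (eq_integral (fun t => (expR (- (x ^+ 2 / (6 * tau ^+ 2))))%:E *
    (expR (- (x ^+ 2 / 2) * bilinear_var t))%:E)%E); last first.
  move=> t _; rewrite /G -EFinM -expRD; congr (expR _)%:E => /=.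
  by rewrite /e; field; rewrite gt_eqF.
rewrite ge0_integralZl//; last first.
  apply/measurable_EFinP; apply: measurableT_comp => //.
  by apply: measurable_funM => //; exact: measurable_bilinear_var.
rewrite EFinM lee_wpmul2l ?lee_fin ?expR_ge0//.
by apply: integral_bilinear_var_le; rewrite ltr_pwDl// sqr_ge0.
Qed.

Lemma bilinear_small_ball (tau : R) : 1 < tau ->
  (P [set t | `|bilinear t| <= tau^-1]%R <=
   (2 / pi * (2 + ln (1 + 2 * tau)) * tau^-1)%:E)%E.
Proof.
move=> tau1; have tau0 : 0 < tau by rewrite (lt_trans _ tau1).
have pi0 := @pi_gt0 R.
apply: (le_trans (bilinear_small_ball_integral tau0)).
apply: (@le_trans _ _ ((tau^-1 / pi)%:E * (2 * (2 + ln (2 * tau)))%:E)%E).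
  rewrite lee_wpmul2l//; first by rewrite lee_fin divr_ge0 ?invr_ge0 ?ltW.
  exact: damped_integral_le.
have lnle : ln (2 * tau) <= ln (1 + 2 * tau).
  by rewrite ler_ln ?posrE ?addr_gt0 ?mulr_gt0// lerDr.
rewrite -EFinM lee_fin.
rewrite (_ : 2 / pi * _ * _ = tau^-1 / pi * (2 * (2 + ln (1 + 2 * tau)))); last by ring.
by rewrite ler_wpM2l ?divr_ge0 ?invr_ge0 ?(ltW tau0) ?(ltW pi0)//; lra.
Qed.

End bilinear_form.

(** * Convexity of the hyperbolic cosine of a square root *)

Section cosh_convexity.
Context {R : realType}.

(** Bernoulli's inequality in homogeneous form: a power lies above its tangents
    on the half-line. *)
Lemma exprn_tangent (q a : R) l : 0 <= q -> 0 <= a ->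
  a ^+ l + l%:R * a ^+ l.-1 * (q - a) <= q ^+ l.
Proof.
move=> q0 a0; elim: l => [|l IH]; first by rewrite !expr0 !mul0r addr0.
rewrite -subr_ge0; case: l IH => [|l] IH.
  by rewrite !expr1 expr0 !mul1r; lra.
rewrite /= in IH *.
rewrite (_ : _ - _ = q * (q ^+ l.+1 - (a ^+ l.+1 + l.+1%:R * a ^+ l * (q - a))) +
   l.+1%:R * a ^+ l * (q - a) ^+ 2).
  have IH' : 0 <= q ^+ l.+1 - (a ^+ l.+1 + l.+1%:R * a ^+ l * (q - a)) by rewrite subr_ge0.
  have H1 := mulr_ge0 q0 IH'.
  have H2 : 0 <= l.+1%:R * a ^+ l by rewrite mulr_ge0// exprn_ge0.
  by rewrite addr_ge0// mulr_ge0// sqr_ge0.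
rewrite -[l.+2%:R]natr1 !exprS; ring.
Qed.

Lemma exprn_convex (I : finType) (p q : I -> R) l :
  (forall i, 0 <= p i) -> \sum_i p i = 1 -> (forall i, 0 <= q i) ->
  (\sum_i p i * q i) ^+ l <= \sum_i p i * q i ^+ l.
Proof.
move=> p0 p1 q0; have : 0 <= \sum_i p i * q i.
  by apply: sumr_ge0 => i _; exact: mulr_ge0.
move aE : (\sum_i p i * q i) => a a0.
(* the tangents at the mean [a] average to the value there *)
have <- : \sum_i p i * (a ^+ l + l%:R * a ^+ l.-1 * (q i - a)) = a ^+ l.
  transitivity (a ^+ l * (\sum_i p i) + l%:R * a ^+ l.-1 * (\sum_i p i * q i)
      - l%:R * a ^+ l.-1 * a * (\sum_i p i)).
    rewrite !mulr_sumr -big_split -sumrB; apply: eq_bigr => i _ /=; ring.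
  by rewrite p1 aE; ring.
by apply: ler_sum => i _; rewrite ler_wpM2l// exprn_tangent.
Qed.

Definition cosh (x : R) := (expR x + expR (- x)) / 2.

Lemma cosh_coeffE (x : R) k :
  (exp_coeff x k + exp_coeff (- x) k) / 2 =
  (~~ odd k)%:R / k`!%:R * (x ^+ 2) ^+ k./2.
Proof.
rewrite /exp_coeff/= exprNn -[(-1) ^+ k]signr_odd.
have k0 : k`!%:R != 0 :> R by rewrite pnatr_eq0 -lt0n fact_gt0.
have [ok|ok] := boolP (odd k) => /=; first by rewrite expr1; field.
have kE : k./2.*2 = k by rewrite -[RHS]odd_double_half (negbTE ok).
by rewrite -exprM mul2n kE expr0; field.
Qed.

Lemma cvg_cosh (x : R) :
  \sum_(0 <= k < n) (exp_coeff x k + exp_coeff (- x) k) / 2 @[n --> \oo] --> cosh x.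
Proof.
rewrite /cosh.
under eq_fun do rewrite -mulr_suml big_split/=.
apply: cvgM; last exact: cvg_cst.
by apply: cvgD; exact: is_cvg_series_exp_coeff.
Qed.

(** Jensen's inequality for [cosh \o sqrt] at the points [z i ^+ 2].  The power
    series in these squares has nonnegative coefficients, so the inequality
    holds term by term for the partial sums, by [exprn_convex]. *)
Lemma cosh_sqrt_convex (I : finType) (p z : I -> R) :
  (forall i, 0 <= p i) -> \sum_i p i = 1 ->
  cosh (Num.sqrt (\sum_i p i * z i ^+ 2)) <= \sum_i p i * cosh (z i).
Proof.
move=> p0 p1; set a := Num.sqrt _.
have a2 : a ^+ 2 = \sum_i p i * z i ^+ 2.
  by rewrite sqr_sqrtr// sumr_ge0// => i _; rewrite mulr_ge0 ?sqr_ge0.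
have cz : \sum_i p i * \sum_(0 <= k < n) (exp_coeff (z i) k + exp_coeff (- z i) k) / 2
    @[n --> \oo] --> \sum_i p i * cosh (z i).
  apply: cvg_big => [|i _]; first exact: add_continuous.
  by apply: cvgM; [exact: cvg_cst|exact: cvg_cosh].
apply: (ler_cvg_to (@cvg_cosh a) cz); apply: nearW => n.
under [leRHS]eq_bigr do rewrite mulr_sumr.
rewrite exchange_big/=; apply: ler_sum => k _.
rewrite cosh_coeffE a2; under eq_bigr do rewrite cosh_coeffE mulrCA.
rewrite -mulr_sumr ler_wpM2l ?divr_ge0//.
by apply: exprn_convex => // i; exact: sqr_ge0.
Qed.

Lemma cosh_ge (x y : R) : 0 <= x -> x <= y -> expR x / 2 <= cosh y.
Proof.
move=> x0 xy; rewrite /cosh ler_wpM2r// ler_wpDr ?expR_ge0// ler_expR//.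
Qed.

End cosh_convexity.

(** * Gaussian bilinear forms: tails *)

Section bilinear_tail.
Context (d : measure_display) (T : measurableType d) (R : realType).
Context (P : probability T R) (m n : nat).
Context (u : 'I_m -> {RV P >-> R}) (v : 'I_n -> {RV P >-> R}).
Hypothesis uv : independent_gaussian_vectors u v.

Let measurable_expR_bilinear (c : 'I_n -> 'I_m -> R) theta :
  measurable_fun setT (fun t => (expR (theta * bilinear u v c t))%:E).
Proof.
apply/measurable_EFinP; apply: measurableT_comp => //.
by apply: measurable_funM => //; exact: measurable_bilinear.
Qed.

Lemma integral_cosh_bilinear_le (c : 'I_n -> 'I_m -> R) (theta : R) :
  \sum_j \sum_i c j i ^+ 2 = 1 -> theta ^+ 2 < 1 ->
  (\int[P]_t (cosh (theta * bilinear u v c t))%:E <=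
   ((Num.sqrt (1 - theta ^+ 2))^-1)%:E)%E.
Proof.
move=> c1 th1.
have th1' : (- theta) ^+ 2 < 1 by rewrite sqrrN.
have -> : (\int[P]_t (cosh (theta * bilinear u v c t))%:E =
    2^-1%:E * (\int[P]_t (expR (theta * bilinear u v c t))%:E +
               \int[P]_t (expR (- theta * bilinear u v c t))%:E))%E.
  rewrite -ge0_integralD//; try by move=> t _; rewrite lee_fin expR_ge0.
  rewrite -ge0_integralZl//; last 2 first.
  - by apply: emeasurable_funD; exact: measurable_expR_bilinear.
  - by move=> t _; rewrite -EFinD lee_fin addr_ge0 ?expR_ge0.
  by apply: eq_integral => t _; rewrite -EFinD -EFinM /cosh mulNr mulrC.
have H1 := integral_expR_bilinear_le uv c1 th1.
have H2 := integral_expR_bilinear_le uv c1 th1'.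
rewrite sqrrN in H2.
apply: (le_trans (lee_wpmul2l _ (leeD H1 H2))); first by rewrite lee_fin.
by rewrite -EFinD -EFinM lee_fin; lra.
Qed.

(** Writing [1 - (1 - tau^-1) ^+ 2] as [(2 * tau - 1) / tau ^+ 2], the claim is
    that [2 <= exp 1 * sqrt (4 - 2 / tau)], which follows from [2 <= exp 1]. *)
Lemma tail_constant_le (tau : R) : 1 < tau ->
  2 * expR (1 - tau) / Num.sqrt (1 - (1 - tau^-1) ^+ 2) <=
  Num.sqrt (2 * tau) * expR (- tau + 2).
Proof.
move=> tau1; have tau0 : 0 < tau by rewrite (lt_trans _ tau1).
have -> : 1 - (1 - tau^-1) ^+ 2 = (2 * tau - 1) / tau ^+ 2 by field; rewrite gt_eqF.
have t1 : 0 < 2 * tau - 1 by lra.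
have s0 : 0 < Num.sqrt ((2 * tau - 1) / tau ^+ 2).
  by rewrite sqrtr_gt0 divr_gt0// exprn_gt0.
rewrite ler_pdivrMr//.
have -> : - tau + 2 = 1 + (1 - tau) by ring.
have e2 : 2 <= expR (1 : R) by rewrite (le_trans _ (expR_ge1Dx 1))// -natr1.
have key : 1 <= Num.sqrt (2 * tau) * Num.sqrt ((2 * tau - 1) / tau ^+ 2).
  rewrite -sqrtrM ?mulr_ge0 ?(ltW tau0)// -[leLHS]sqrtr1 ler_wsqrtr//.
  rewrite (_ : 2 * tau * _ = (4 * tau - 2) / tau); last by field; rewrite gt_eqF.
  by rewrite ler_pdivlMr//; lra.
rewrite (expRD 1 (1 - tau)).
rewrite (_ : _ * _ * _ = (expR 1 * (Num.sqrt (2 * tau) *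
  Num.sqrt ((2 * tau - 1) / tau ^+ 2))) * expR (1 - tau)); last by ring.
rewrite ler_wpM2r ?expR_ge0// -[leLHS]mulr1.
by rewrite ler_pM.
Qed.

(** Markov's inequality for the convex function [cosh (theta * sqrt _)] of the
    weighted mean.  With [theta = 1 - tau^-1] the exponent gained,
    [theta * tau], is [tau - 1], while [1 - theta ^+ 2] is still of the order
    of [tau^-1]. *)
Lemma bilinear_tail (J : finType) (p : J -> R) (c : J -> 'I_n -> 'I_m -> R) (tau : R) :
  (forall k, 0 <= p k) -> \sum_k p k = 1 ->
  (forall k, \sum_j \sum_i c k j i ^+ 2 = 1) -> 1 < tau ->
  (P [set t | tau ^+ 2 <= \sum_k p k * bilinear u v (c k) t ^+ 2]%R <=
   (Num.sqrt (2 * tau) * expR (- tau + 2))%:E)%E.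
Proof.
move=> p0 p1 c1 tau1; have tau0 : 0 < tau by rewrite (lt_trans _ tau1).
pose theta := 1 - tau^-1.
have th0 : 0 <= theta by rewrite subr_ge0 invf_le1// ltW.
have th1 : theta ^+ 2 < 1.
  by rewrite expr_lt1// ltrBlDr ltrDl invr_gt0.
pose g t := \sum_k p k * cosh (theta * bilinear u v (c k) t).
pose K := expR (theta * tau) / 2; have K0 : 0 < K by rewrite divr_gt0 ?expR_gt0.
set E := [set t | _].
have mE : measurable E.
  have mQ : measurable_fun setT (fun t => \sum_k p k * bilinear u v (c k) t ^+ 2).
    apply: measurable_sum => k; apply: measurable_funM => //.
    by apply: measurable_funX; exact: measurable_bilinear.
  rewrite (_ : E = (fun t => \sum_k p k * bilinear u v (c k) t ^+ 2) @^-1`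
    [set` `[tau ^+ 2, +oo[]); last first.
    by apply/seteqP; split => t /=; rewrite in_itv/= andbT.
  by rewrite -[X in measurable X]setTI; exact: mQ.
have gE t : E t -> K <= g t.
  move=> Et; rewrite (le_trans _ (cosh_sqrt_convex _ p0 p1))//.
  apply: cosh_ge; first by rewrite mulr_ge0// ltW.
  under eq_bigr do rewrite exprMn mulrCA.
  rewrite -mulr_sumr sqrtrM ?sqr_ge0// sqrtr_sqr ger0_norm// ler_wpM2l//.
  by rewrite -(gtr0_norm tau0) -sqrtr_sqr ler_wsqrtr.
have cosh_ge0 x : 0 <= cosh x :> R by rewrite divr_ge0// addr_ge0 ?expR_ge0.
have mcosh k : measurable_fun setT (fun t => (cosh (theta * bilinear u v (c k) t))%:E).
  apply/measurable_EFinP; rewrite /cosh; apply: measurable_funM => //.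
  apply: measurable_funD; first exact/measurable_EFinP/measurable_expR_bilinear.
  under eq_fun do rewrite -mulNr.
  exact/measurable_EFinP/measurable_expR_bilinear.
have g0 t : 0 <= g t by apply: sumr_ge0 => k _; rewrite mulr_ge0.
have int_g : (\int[P]_t (g t)%:E <= ((Num.sqrt (1 - theta ^+ 2))^-1)%:E)%E.
  under eq_integral do rewrite -sumEFin.
  rewrite ge0_integral_sum//; last 2 first.
  - by move=> k; under eq_fun do rewrite EFinM; exact: emeasurable_funM.
  - by move=> k t _; rewrite lee_fin mulr_ge0.
  apply: (@le_trans _ _ ((\sum_k p k * (Num.sqrt (1 - theta ^+ 2))^-1)%R%:E)%E).
    rewrite -sumEFin; apply: lee_sum => k _; under eq_integral do rewrite EFinM.
    rewrite ge0_integralZl//; [|by move=> t _; rewrite lee_fin|by rewrite lee_fin].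
    by rewrite EFinM lee_wpmul2l ?lee_fin//; exact: integral_cosh_bilinear_le.
  by rewrite -mulr_suml p1 mul1r.
have markovE : (K%:E * P E <= \int[P]_t (g t)%:E)%E.
  rewrite -[X in (_ * P X)%E]setIT -integral_indic// -ge0_integralZl//; last 2 first.
  - by apply/measurable_EFinP; exact: measurable_indic.
  - by rewrite lee_fin ltW.
  apply: ge0_le_integral => //.
  - by move=> t _; rewrite -EFinM lee_fin mulr_ge0 ?(ltW K0)// indicE.
  - by apply: emeasurable_funM => //; apply/measurable_EFinP; exact: measurable_indic.
  - apply/measurable_EFinP; apply: measurable_sum => k; apply: measurable_funM => //.
    by apply/measurable_EFinP; exact: mcosh.
  move=> t _; rewrite -EFinM lee_fin indicE.
  have [/set_mem/gE|_] := boolP (t \in E); first by rewrite mulr1.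
  by rewrite mulr0.
apply: (@le_trans _ _ (K^-1 / Num.sqrt (1 - theta ^+ 2))%:E).
  rewrite -[P E]mul1e -[1%E](_ : (K^-1%:E * K%:E)%E = _); last first.
    by rewrite -EFinM mulVf// gt_eqF.
  rewrite -muleA (EFinM K^-1) lee_wpmul2l ?lee_fin ?invr_ge0 ?(ltW K0)//.
  exact: le_trans markovE int_g.
rewrite lee_fin (le_trans _ (tail_constant_le tau1))// -/theta.
rewrite ler_wpM2r ?invr_ge0 ?sqrtr_ge0//.
rewrite /K invf_div -expRN (_ : - (theta * tau) = 1 - tau)//.
by rewrite /theta; field; rewrite gt_eqF.
Qed.

End bilinear_tail.

(** * Diagonalizing a symmetric form by maximization *)

Lemma continuous_sum (R : realType) (V : topologicalType) (I : finType)
    (F : I -> V -> R) :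
  (forall i, continuous (F i)) -> continuous (fun x => \sum_i F i x).
Proof.
move=> cF x; apply: cvg_big => [|i _]; first exact: add_continuous.
exact: cF.
Qed.

Section rayleigh.
Context {R : realType} (k : nat).
Variable G : 'M[R]_k.
Hypothesis symG : G^T = G.
Implicit Types x y : 'rV[R]_k.

Definition dot x y : R := (x *m y^T) 0 0.
Definition form x y : R := (x *m G *m y^T) 0 0.

Lemma dotE x y : dot x y = \sum_l x 0 l * y 0 l.
Proof. by rewrite /dot mxE; apply: eq_bigr => l _; rewrite mxE. Qed.

Lemma dotC x y : dot x y = dot y x.
Proof. by rewrite !dotE; apply: eq_bigr => l _; rewrite mulrC. Qed.

Lemma formC x y : form x y = form y x.
Proof.
rewrite /form -[x *m G *m y^T]trmxK [LHS]mxE.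
by rewrite !trmx_mul trmxK symG mulmxA.
Qed.

Lemma dotDZl a x y z : dot (x + a *: y) z = dot x z + a * dot y z.
Proof. by rewrite /dot mulmxDl -scalemxAl !mxE. Qed.

Lemma formDZ a x y :
  form (x + a *: y) (x + a *: y) =
  form x x + 2 * a * form x y + form y y * a ^+ 2.
Proof.
transitivity (form x x + a * form x y + (a * form y x + a * (a * form y y))).
  rewrite /form linearD/= linearZ/= !mulmxDl !mulmxDr -!scalemxAl -!scalemxAr.
  by rewrite !mxE.
by rewrite (formC y x); ring.
Qed.

Lemma dot_ge0 x : 0 <= dot x x.
Proof. by rewrite dotE sumr_ge0// => l _; rewrite -expr2 sqr_ge0. Qed.

Lemma dot_eq0 x : dot x x = 0 -> x = 0.
Proof.
rewrite dotE => /eqP; rewrite psumr_eq0 => [/allP x0|l _]; last first.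
  by rewrite -expr2 sqr_ge0.
apply/rowP => l; rewrite mxE; apply/eqP.
by have := x0 l (mem_index_enum _); rewrite /= mulf_eq0 orbb.
Qed.

Lemma dotZZ a x y : dot (a *: x) (a *: y) = a ^+ 2 * dot x y.
Proof. by rewrite !dotE mulr_sumr; apply: eq_bigr => l _; rewrite !mxE; ring. Qed.

Lemma dotZl a x y : dot (a *: x) y = a * dot x y.
Proof. by rewrite !dotE mulr_sumr; apply: eq_bigr => l _; rewrite !mxE mulrA. Qed.

Lemma formZZ a x : form (a *: x) (a *: x) = a ^+ 2 * form x x.
Proof.
rewrite /form linearZ/= -!scalemxAl -scalemxAr scalerA mxE; congr (_ * _).
Qed.

(** A linear map to a space of smaller dimension has a nonzero kernel. *)
Lemma exists_unit_orthogonal (j : nat) (U : nat -> 'rV[R]_k) : (j < k)%N ->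
  exists x, dot x x = 1 /\ forall i, (i < j)%N -> dot x (U i) = 0.
Proof.
move=> jk; pose A : 'M[R]_(k, j) := \matrix_(l, i) U i 0 l.
have /rowV0Pn[x /sub_kermxP xA x0] : kermx A != 0.
  rewrite kermx_eq0 /row_free; apply/eqP => rA.
  by have := rank_leq_col A; rewrite rA leqNgt jk.
have xx : 0 < dot x x.
  rewrite lt_neqAle dot_ge0 andbT eq_sym; apply/eqP => /dot_eq0 /eqP.
  by rewrite (negbTE x0).
exists ((Num.sqrt (dot x x))^-1 *: x); split.
  by rewrite dotZZ exprVn sqr_sqrtr ?dot_ge0// mulVf// gt_eqF.
move=> i ij; rewrite dotZl; apply/eqP; rewrite mulf_eq0; apply/orP; right.
have /rowP/(_ (Ordinal ij)) := xA; rewrite !mxE => xU; apply/eqP.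
by rewrite dotE -[RHS]xU; apply: eq_bigr => l _; rewrite mxE.
Qed.

Let sphere (j : nat) (U : nat -> 'rV[R]_k) : set 'rV[R]_k :=
  [set x | dot x x = 1 /\ forall i, (i < j)%N -> dot x (U i) = 0].

Lemma continuous_dot (y : 'rV[R]_k) : continuous (fun x : 'rV[R]_k => dot x y).
Proof.
rewrite (_ : (fun x => _) = fun x : 'rV[R]_k => \sum_l x 0 l * y 0 l); last first.
  by apply/funext => x; exact: dotE.
apply: (@continuous_sum _ _ _ (fun l (x : 'rV[R]_k) => x 0 l * y 0 l)) => l x.
apply: (@continuousM _ _ (fun x : 'rV[R]_k => x 0 l) (fun=> y 0 l)).
  exact: coord_continuous.
exact: cst_continuous.
Qed.

Lemma continuous_dotxx : continuous (fun x : 'rV[R]_k => dot x x).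
Proof.
rewrite (_ : (fun x => _) = fun x : 'rV[R]_k => \sum_l x 0 l * x 0 l); last first.
  by apply/funext => x; exact: dotE.
apply: (@continuous_sum _ _ _ (fun l (x : 'rV[R]_k) => x 0 l * x 0 l)) => l x.
by apply: (@continuousM _ _ (fun x : 'rV[R]_k => x 0 l)); exact: coord_continuous.
Qed.

Lemma continuous_form : continuous (fun x : 'rV[R]_k => form x x).
Proof.
rewrite (_ : (fun x => _) = fun x : 'rV[R]_k =>
    \sum_l (\sum_l' x 0 l' * G l' l) * x 0 l); last first.
  apply/funext => x; rewrite /form mxE; apply: eq_bigr => l _.
  by rewrite !mxE.
apply: continuous_sum => l x.
apply: (@continuousM _ _ (fun x : 'rV[R]_k => \sum_l' x 0 l' * G l' l)
  (fun x => x 0 l)); last exact: coord_continuous.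
apply: continuous_sum => l' {}x.
apply: (@continuousM _ _ (fun x : 'rV[R]_k => x 0 l') (fun=> G l' l)).
  exact: coord_continuous.
exact: cst_continuous.
Qed.

Lemma sphere_compact j U : compact (sphere j U).
Proof.
apply: (@subclosed_compact _ _
  [set x : 'rV[R]_k | forall l, `[(-1)%R, 1%R]%classic (x ord0 l)]).
- rewrite (_ : sphere j U = (fun x => dot x x) @^-1` [set 1] `&`
      \bigcap_(i in [set i | (i < j)%N]) ((dot ^~ (U i)) @^-1` [set 0])).
    apply: closedI.
      by apply: preimage_closed; [move=> x _; exact: continuous_dotxx|exact: closed_eq].
    apply: closed_bigI => i _.
    by apply: preimage_closed; [move=> x _; exact: continuous_dot|exact: closed_eq].
  by apply/seteqP; split => x [xx xU]; split.
- exact: (@rV_compact R k (fun=> `[(-1)%R, 1%R]%classic)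
    (fun l => @segment_compact R _ _)).
- move=> x [xx _] l /=; rewrite in_itv/= -ler_norml.
  rewrite -(@ler_pXn2r _ 2)// ?nnegrE// expr1n real_normK ?num_real// -xx.
  rewrite dotE (bigD1 l)//= -expr2 lerDl sumr_ge0// => l' _.
  by rewrite -expr2 sqr_ge0.
Qed.

Lemma rayleigh_step (j : nat) (U : nat -> 'rV[R]_k) : (j < k)%N ->
  exists2 x, sphere j U x & forall y, sphere j U y -> form y y <= form x x.
Proof.
move=> jk; have [x0 Sx0] := exists_unit_orthogonal U jk.
have [||x Sx max_x] := @compact_EVT_max _ R (fun x => form x x) (sphere j U) _
  (@sphere_compact j U).
- by exists x0.
- exact/continuous_subspaceT/continuous_form.
by exists x => [|y Sy]; [exact/set_mem|apply: max_x; exact/mem_set].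
Qed.

(** The spectral theorem in the form needed.  Choose [U i] successively, to
    maximize the form on the unit sphere of the complement of the previous
    vectors.  For [i < j] the maximum at [U i] is not exceeded along
    [U i + t * U j], which forces the term linear in [t] to vanish: this is
    orthogonality of [U i] and [U j] for the form. *)
Lemma form_orthogonal_basis : exists U : nat -> 'rV[R]_k,
  (forall i j, (i < k)%N -> (j < k)%N -> dot (U i) (U j) = (i == j)%:R) /\
  (forall i j, (i < k)%N -> (j < k)%N -> (i <= j)%N ->
     form (U j) (U j) <= form (U i) (U i) /\ (i != j -> form (U i) (U j) = 0)).
Proof.
suff [U HU] : exists U : nat -> 'rV[R]_k, forall i, (i < k)%N ->
    sphere i U (U i) /\ forall y, sphere i U y -> form y y <= form (U i) (U i).
  have orth i j : (i < j)%N -> (j < k)%N -> dot (U j) (U i) = 0.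
    by move=> ij jk; have [[_ +] _] := HU _ jk; apply.
  have unit i : (i < k)%N -> dot (U i) (U i) = 1.
    by move=> ik; have [[]] := HU _ ik.
  exists U; split => [i j ik jk|i j ik jk].
    have [ij|ij|ij] := ltngtP i j; last by rewrite -ij unit.
      by rewrite dotC orth.
    by rewrite orth.
  have Sij i' j' : (i' <= j')%N -> (j' < k)%N -> sphere i' U (U j').
    move=> ij jk'; split; first exact: unit.
    by move=> l li; rewrite orth// (leq_trans li).
  move=> ij; have [_ max_i] := HU _ ik; have le_ij := max_i _ (Sij _ _ ij jk).
  split => // ij'; have {ij ij'}ij : (i < j)%N by rewrite ltn_neqAle ij'.
  have H : forall t, 0 <= 0 + 2 * t * - form (U i) (U j) +
      (form (U i) (U i) - form (U j) (U j)) * t ^+ 2.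
    move=> t; have t0 : 0 < 1 + t ^+ 2 by rewrite ltr_pwDl// sqr_ge0.
    have := max_i ((Num.sqrt (1 + t ^+ 2))^-1 *: (U i + t *: U j)).
    rewrite formZZ exprVn (sqr_sqrtr (ltW t0)) formDZ ler_pdivrMl// => H.
    suff /H : sphere i U ((Num.sqrt (1 + t ^+ 2))^-1 *: (U i + t *: U j)) by lra.
    split.
      rewrite dotZZ exprVn (sqr_sqrtr (ltW t0)) dotDZl.
      rewrite [dot (U i) _]dotC [dot (U j) _]dotC !dotDZl !unit//.
      rewrite [dot (U i) (U j)]dotC !orth//.
      by field; rewrite gt_eqF.
    move=> l li; rewrite dotZl dotDZl !orth// ?(ltn_trans li)//.
    by rewrite mulr0 addr0 mulr0.
  apply/eqP; rewrite -oppr_eq0 -sqrf_eq0 eq_le sqr_ge0 andbT.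
  have := discriminant_le _ H; rewrite mulr0; apply.
  by rewrite subr_ge0.
suff : forall K, (K <= k)%N -> exists U : nat -> 'rV[R]_k, forall i, (i < K)%N ->
    sphere i U (U i) /\ forall y, sphere i U y -> form y y <= form (U i) (U i).
  by move=> /(_ k (leqnn k)).
elim=> [|K IH] Kk; first by exists (fun=> 0).
have [U HU] := IH (ltnW Kk).
have [x Sx max_x] := rayleigh_step U Kk.
pose V i := if i == K then x else U i.
have SE i : (i <= K)%N -> sphere i V = sphere i U.
  move=> iK; apply/seteqP; split => y [yy yU]; split => // l li.
    have := yU l li; rewrite /V (_ : (l == K) = false)//.
    by apply: ltn_eqF; exact: leq_trans iK.
  rewrite /V (_ : (l == K) = false) ?yU//.
  by apply: ltn_eqF; exact: leq_trans iK.
exists V => i; rewrite ltnS leq_eqVlt => /predU1P[->|iK].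
  by rewrite SE// /V eqxx.
by rewrite SE ?(ltnW iK)// /V (ltn_eqF iK); exact: HU.
Qed.

End rayleigh.

(** * Square-integrable functions *)

Section square_integrable.
Context (d : measure_display) (T : measurableType d) (R : realType).
Context (mu : {measure set T -> \bar R}) (D : set T).
Hypothesis mD : measurable D.
Implicit Types f g h : T -> R.

Definition sqint f : Prop := measurable_fun D f /\
  mu.-integrable D (fun z => ((f z) ^+ 2)%:E).

Definition ip f g : R := \int[mu]_(z in D) (f z * g z).

Lemma sqintM f g : sqint f -> sqint g ->
  mu.-integrable D (fun z => (f z * g z)%:E).
Proof.
move=> [mf f2] [mg g2].
apply: (le_integrable mD _ _ (integrableD mD f2 g2)).
  by apply/measurable_EFinP; exact: measurable_funM.
move=> z _ /=; rewrite lee_fin [leRHS]ger0_norm ?addr_ge0 ?sqr_ge0//.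
rewrite ler_norml; apply/andP; split.
  have := sqr_ge0 (f z + g z); nra.
have := sqr_ge0 (f z - g z); nra.
Qed.

Lemma sqintDZ a f g : sqint f -> sqint g -> sqint (fun z => f z + a * g z).
Proof.
move=> sf sg; have [[mf f2] [mg g2]] := (sf, sg); split.
  by apply: measurable_funD => //; exact: measurable_funM.
rewrite (_ : (fun z => _) = (fun z => ((f z) ^+ 2)%:E +
  ((2 * a)%:E * (f z * g z)%:E + (a ^+ 2)%:E * ((g z) ^+ 2)%:E))%E).
  apply: integrableD => //; apply: integrableD => //; apply: integrableZl => //.
  exact: sqintM.
by apply/funext => z; rewrite -!EFinM -!EFinD; congr (_%:E); ring.
Qed.

Lemma sqint0 : sqint (fun=> 0).
Proof.
split=> //.
rewrite (_ : (fun z => _) = cst 0%E); first exact: integrable0.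
by apply/funext => z /=; rewrite expr0n.
Qed.

Lemma sqintZ a f : sqint f -> sqint (fun z => a * f z).
Proof.
move=> sf; have := sqintDZ a sqint0 sf.
by under eq_fun do rewrite add0r.
Qed.

Lemma sqint_sum (I : Type) (s : seq I) (c : I -> R) (F : I -> T -> R) :
  (forall i, sqint (F i)) -> sqint (fun z => \sum_(i <- s) c i * F i z).
Proof.
move=> sF; elim: s => [|i s IH].
  by under eq_fun do rewrite big_nil; exact: sqint0.
under eq_fun do rewrite big_cons addrC.
exact: sqintDZ.
Qed.

Lemma ipC f g : ip f g = ip g f.
Proof. by apply: eq_Rintegral => z _; rewrite mulrC. Qed.

Lemma ipDZl a f g h : sqint f -> sqint g -> sqint h ->
  ip (fun z => f z + a * g z) h = ip f h + a * ip g h.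
Proof.
move=> sf sg sh; rewrite /ip.
under eq_Rintegral do rewrite mulrDl -mulrA.
rewrite RintegralD//; last 2 first.
- exact: sqintM.
- rewrite (_ : _ \o _ = fun z => a%:E * (g z * h z)%:E)%E//.
  by apply: integrableZl => //; exact: sqintM.
by rewrite RintegralZl//; exact: sqintM.
Qed.

Lemma ip0l h : ip (fun=> 0) h = 0.
Proof.
rewrite /ip; under eq_Rintegral do rewrite mul0r.
by rewrite /Rintegral integral0.
Qed.

Lemma ipZl a f h : sqint f -> sqint h -> ip (fun z => a * f z) h = a * ip f h.
Proof.
move=> sf sh; have := ipDZl a sqint0 sf sh; rewrite ip0l add0r => <-.
by congr ip; apply/funext => z; rewrite add0r.
Qed.

Lemma ip_suml (I : Type) (s : seq I) (c : I -> R) (F : I -> T -> R) h :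
  (forall i, sqint (F i)) -> sqint h ->
  ip (fun z => \sum_(i <- s) c i * F i z) h = \sum_(i <- s) c i * ip (F i) h.
Proof.
move=> sF sh; elim: s => [|i s IH].
  by under eq_fun do rewrite big_nil; rewrite big_nil ip0l.
under eq_fun do rewrite big_cons addrC.
by rewrite ipDZl//; [rewrite IH big_cons addrC|exact: sqint_sum].
Qed.

Lemma Rintegral_sum (I : Type) (s : seq I) (F : I -> T -> R) :
  (forall i, mu.-integrable D (fun z => (F i z)%:E)) ->
  \int[mu]_(z in D) (\sum_(i <- s) F i z) = \sum_(i <- s) \int[mu]_(z in D) F i z.
Proof.
move=> iF; elim: s => [|i s IH].
  rewrite big_nil /Rintegral (eq_integral (cst 0%E)) ?integral0// => z _.
  by rewrite big_nil.
under eq_Rintegral do rewrite big_cons.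
rewrite RintegralD// ?IH ?big_cons//; first exact: iF.
rewrite (_ : _ \o _ = fun z => (\sum_(i <- s) (F i z)%:E)%E); last first.
  by apply/funext => z /=; rewrite sumEFin.
exact: integrable_sum.
Qed.

Lemma ip_ge0 f : 0 <= ip f f.
Proof. by apply: Rintegral_ge0 => z _; rewrite -expr2 sqr_ge0. Qed.

Lemma ip_eq0 f : sqint f -> ip f f = 0 -> {ae mu, forall z, D z -> f z = 0}.
Proof.
move=> [mf f2] f0.
have : (\int[mu]_(z in D) `|((f z) ^+ 2)%:E| = 0)%E.
  under eq_integral do rewrite gee0_abs ?lee_fin ?sqr_ge0//.
  have fin := integrable_fin_num mD f2.
  rewrite -[LHS]fineK//; congr (_%:E); rewrite -f0.
  by rewrite /ip /Rintegral; under eq_integral do rewrite expr2.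
move/ae_eq_integral_abs; have := measurable_int mu f2 => m2 /(_ mD m2).
apply: filterS => z /[apply] /= -[] /eqP; rewrite sqrf_eq0 => /eqP //.
Qed.

(* Infinitely many disjoint sets of positive finite measure make the space of
   square-integrable functions infinite-dimensional. *)
Variable E : nat -> set T.
Hypothesis mE : forall l, measurable (E l).
Hypothesis ED : forall l, E l `<=` D.
Hypothesis muE : forall l, (0 < mu (E l) < +oo)%E.
Hypothesis tE : forall i j, i != j -> E i `&` E j = set0.

Lemma sqint_indic l : sqint (fun z => \1_(E l) z).
Proof.
split; first exact: measurable_indic.
rewrite (_ : (fun z => _) = EFin \o \1_(E l)); last first.
  by apply/funext => z /=; rewrite indicE; case: (_ \in _); rewrite ?expr1n ?expr0n.
apply/integrableP; split; first exact/measurable_EFinP.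
rewrite (eq_integral (fun z => (\1_(E l) z)%:E)); last first.
  by move=> z _; rewrite gee0_abs// lee_fin.
rewrite integral_indic// (le_lt_trans (measureIl _ _ _))//.
by have /andP[] := muE l.
Qed.

Lemma ip_indic i j : ip \1_(E i) \1_(E j) = (i == j)%:R * fine (mu (E i)).
Proof.
rewrite /ip /Rintegral.
rewrite (eq_integral (fun z => (\1_(E i `&` E j) z)%:E)); last by rewrite indicI.
rewrite integral_indic//; last exact: measurableI.
have [->|ij] := eqVneq i j; first by rewrite setIid mul1r setIidl.
by rewrite tE// set0I measure0 mul0r.
Qed.

(** [K] linear conditions on the [K.+1] coefficients of a combination of
    indicator functions of disjoint sets leave a nonzero solution. *)
Lemma exists_unit_ip_orthogonal (K : nat) (v : nat -> T -> R) :
  (forall i, (i < K)%N -> sqint (v i)) ->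
  exists2 f, sqint f /\ ip f f = 1 & forall i, (i < K)%N -> ip f (v i) = 0.
Proof.
move=> sv; pose A : 'M[R]_(K.+1, K) := \matrix_(l, i) ip \1_(E l) (v i).
have /rowV0Pn[c /sub_kermxP cA c0] : kermx A != 0.
  rewrite kermx_eq0 /row_free; apply/eqP => rA.
  by have := rank_leq_col A; rewrite rA ltnn.
pose f z := \sum_(l < K.+1) c 0 l * \1_(E l) z.
have sf : sqint f by apply: sqint_sum => l; exact: sqint_indic.
have ipf g : sqint g -> ip f g = \sum_(l < K.+1) c 0 l * ip \1_(E l) g.
  by move=> sg; rewrite /f ip_suml// => l; exact: sqint_indic.
have ipfv i : (i < K)%N -> ip f (v i) = 0.
  move=> iK; rewrite ipf; last exact: sv.
  have /rowP/(_ (Ordinal iK)) := cA; rewrite !mxE => cAi.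
  by rewrite -[RHS]cAi; apply: eq_bigr => l _; rewrite mxE.
have ff : ip f f = \sum_(l < K.+1) c 0 l ^+ 2 * fine (mu (E l)).
  rewrite ipf//; apply: eq_bigr => l _; rewrite ipC ipf; last exact: sqint_indic.
  rewrite (bigD1 l)//= ip_indic eqxx mul1r big1 ?addr0 ?mulrA ?expr2// => l' l'l.
  by rewrite ip_indic (_ : (_ == _) = false) ?mul0r ?mulr0//; exact: negbTE.
have ff0 : 0 < ip f f.
  have /rV0Pn[l cl0] := c0; rewrite ff (bigD1 l)//= ltr_pwDl//.
    rewrite mulr_gt0 ?exprn_even_gt0//= fine_gt0//.
  by apply: sumr_ge0 => l' _; rewrite mulr_ge0 ?sqr_ge0 ?fine_ge0.
pose a := (Num.sqrt (ip f f))^-1.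
exists (fun z => a * f z); [split|].
- exact: sqintZ.
- rewrite (ipZl a sf (sqintZ a sf)) (ipC f) (ipZl a sf sf).
  rewrite mulrA -expr2 exprVn sqr_sqrtr ?(ltW ff0)// mulVf// gt_eqF//.
- by move=> i iK; rewrite (ipZl a sf (sv i iK)) ipfv// mulr0.
Qed.

End square_integrable.

(** * Singular value decomposition of a vector of functions *)

Section singular_value_decomposition.
Context (d : measure_display) (T : measurableType d) (R : realType).
Context (mu : {measure set T -> \bar R}) (D : set T).
Hypothesis mD : measurable D.
Variable E : nat -> set T.
Hypothesis mE : forall l, measurable (E l).
Hypothesis ED : forall l, E l `<=` D.
Hypothesis muE : forall l, (0 < mu (E l) < +oo)%E.
Hypothesis tE : forall i j, i != j -> E i `&` E j = set0.
Variables (k : nat) (h : 'I_k -> T -> R).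
Hypothesis sh : forall i, sqint mu D (h i).

Let G : 'M[R]_k := \matrix_(i, j) ip mu D (h i) (h j).

Let symG : G^T = G.
Proof. by apply/matrixP => i j; rewrite !mxE ipC. Qed.

Let w (x : 'rV[R]_k) (z : T) : R := \sum_l x 0 l * h l z.

Let sqint_w x : sqint mu D (w x).
Proof. exact: sqint_sum. Qed.

Let ip_w x y : ip mu D (w x) (w y) = form G x y.
Proof.
rewrite /w ip_suml//; last exact: sqint_w.
rewrite /form -mulmxA mxE; apply: eq_bigr => l _; congr (_ * _).
rewrite ipC ip_suml// mxE; apply: eq_bigr => l' _.
by rewrite !mxE mulrC ipC.
Qed.

(** The functions [w (U j)] are orthogonal, with squared norms [s j ^+ 2] in
    decreasing order, so the indices with [s j > 0] come first.  Those
    functions are normalized, and each later index receives some unit function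
    orthogonal to all the earlier ones. *)
Lemma complete_orthonormal (U : nat -> 'rV[R]_k) :
  (forall i j, (i < k)%N -> (j < k)%N -> (i <= j)%N ->
     form G (U j) (U j) <= form G (U i) (U i) /\
     (i != j -> form G (U i) (U j) = 0)) ->
  let s j := Num.sqrt (form G (U j) (U j)) in
  exists v : nat -> T -> R, forall j, (j < k)%N ->
    [/\ sqint mu D (v j), forall i, (i < k)%N -> ip mu D (v i) (v j) = (i == j)%:R
      & 0 < s j -> v j = fun z => (s j)^-1 * w (U j) z].
Proof.
move=> HU s.
have s2 j : s j ^+ 2 = form G (U j) (U j).
  by rewrite sqr_sqrtr// -ip_w ip_ge0.
suff : forall K, (K <= k)%N -> exists v : nat -> T -> R, forall j, (j < K)%N ->
    [/\ sqint mu D (v j), forall i, (i < K)%N -> ip mu D (v i) (v j) = (i == j)%:R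
      & 0 < s j -> v j = fun z => (s j)^-1 * w (U j) z].
  by move=> /(_ k (leqnn k)).
elim=> [|K IH] Kk; first by exists (fun _ _ => 0).
have [v Hv] := IH (ltnW Kk).
have sv i : (i < K)%N -> sqint mu D (v i) by case/Hv.
suff [f [sf ff fv fw]] : exists f, [/\ sqint mu D f, ip mu D f f = 1,
    forall i, (i < K)%N -> ip mu D f (v i) = 0
    & 0 < s K -> f = fun z => (s K)^-1 * w (U K) z].
  exists (fun i => if i == K then f else v i) => j.
  rewrite ltnS leq_eqVlt => /predU1P[->|jK].
    rewrite eqxx; split => // i; rewrite ltnS leq_eqVlt => /predU1P[->|iK].
      by rewrite eqxx.
    by rewrite (ltn_eqF iK) ipC fv.
  have [svj vv vw] := Hv _ jK.
  rewrite (ltn_eqF jK); split => // i; rewrite ltnS leq_eqVlt => /predU1P[->|iK].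
    by rewrite eqxx fv// eq_sym (ltn_eqF jK).
  by rewrite (ltn_eqF iK) vv.
have [sK|sK] := ltP 0 (s K).
  exists (fun z => (s K)^-1 * w (U K) z).
  have sf : sqint mu D (fun z => (s K)^-1 * w (U K) z) by exact: sqintZ.
  split => //.
    rewrite (ipZl mD _ (sqint_w _) sf) ipC (ipZl mD _ (sqint_w _) (sqint_w _)) ip_w -s2.
    by field; rewrite gt_eqF.
  move=> i iK; have ik := ltn_trans iK Kk.
  have [le_s /(_ (negbT (ltn_eqF iK))) iK0] := HU _ _ ik Kk (ltnW iK).
  have [_ _ ->] := Hv _ iK; last first.
    by rewrite (lt_le_trans sK)// ler_wsqrtr.
  rewrite (ipZl mD _ (sqint_w _) (sqintZ mD _ (sqint_w _))) ipC.
  by rewrite (ipZl mD _ (sqint_w _) (sqint_w _)) ip_w iK0 !mulr0.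
have [f [sf ff] fv] := exists_unit_ip_orthogonal mD mE ED muE tE sv.
by exists f; split => //; rewrite ltNge sK.
Qed.

(** Since the [U j] form an orthonormal basis of the coefficient space, [h] is
    recovered from the functions [w (U j)]; where [s j] vanishes, so does
    [w (U j)] almost everywhere. *)
Lemma singular_value_decomposition :
  exists (s : nat -> R) (u : 'I_k -> 'cV[R]_k) (v : 'I_k -> T -> R),
  [/\ forall i j, \sum_(l < k) u i l 0 * u j l 0 = (i == j)%:R,
      forall j, sqint mu D (v j),
      forall i j, ip mu D (v i) (v j) = (i == j)%:R,
      (forall j, 0 <= s j) /\
      (forall i j, (i <= j)%N -> (j < k)%N -> s j <= s i)
    & {ae mu, forall z, D z -> forall i,
        h i z = \sum_(j < k) s j * v j z * u j i 0}].
Proof.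
have [U [orthU HU]] := form_orthogonal_basis symG.
have [v Hv] := complete_orthonormal HU.
pose s j := Num.sqrt (form G (U j) (U j)).
exists s, (fun j => (U j)^T), (fun j => v j); split.
- move=> i j; have := orthU _ _ (ltn_ord i) (ltn_ord j).
  by rewrite dotE => <-; apply: eq_bigr => l _; rewrite !mxE.
- by move=> j; have [] := Hv _ (ltn_ord j).
- by move=> i j; have [_ + _] := Hv _ (ltn_ord j); apply.
- split=> [j|i j ij jk]; first exact: sqrtr_ge0.
  by have [le_s _] := HU _ _ (leq_ltn_trans ij jk) jk ij; rewrite ler_wsqrtr.
have ws j : (j < k)%N -> {ae mu, forall z, D z -> w (U j) z = s j * v j z}.
  move=> jk; have [svj _ vw] := Hv _ jk; have [sj|sj] := ltP 0 (s j).
    apply: aeW => z _; rewrite vw// mulVKf// gt_eqF//.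
  have sj0 : s j = 0 by apply/eqP; rewrite eq_le sj sqrtr_ge0.
  have : ip mu D (w (U j)) (w (U j)) = 0.
    rewrite ip_w -[LHS]sqr_sqrtr; last by rewrite -ip_w ip_ge0.
    by rewrite -/(s j) sj0 expr0n.
  move=> /(ip_eq0 mD (sqint_w _)); apply: filterS => z /[apply] ->.
  by rewrite sj0 mul0r.
(* the finitely many exceptional sets are merged *)
have : {ae mu, forall z, forall j : 'I_k, D z -> w (U j) z = s j * v j z}.
  by apply: filter_forall => j; exact: ws.
apply: filterS => z Hz Dz i.
under eq_bigr do rewrite -Hz// mxE.
pose M : 'M[R]_k := \matrix_(j, l) U j 0 l.
(* a square matrix with orthonormal rows has orthonormal columns *)
have /mulmx1C MM : M *m M^T = 1%:M.
  apply/matrixP => j j'; rewrite !mxE -(orthU _ _ (ltn_ord j) (ltn_ord j')) dotE.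
  by apply: eq_bigr => l _; rewrite !mxE.
under eq_bigr do rewrite /w mulr_suml.
rewrite exchange_big/= (bigD1 i)//= [X in _ + X]big1 ?addr0 => [|l li].
- have /matrixP/(_ i i) := MM; rewrite !mxE eqxx mulr1n => M1.
  rewrite -[LHS]mul1r -M1 mulr_suml; apply: eq_bigr => j _; rewrite !mxE; ring.
- have /matrixP/(_ i l) := MM; rewrite !mxE eq_sym (negbTE li) mulr0n => M0.
  rewrite -[RHS](mul0r (h l z)) -[X in _ = X * _]M0 mulr_suml.
  by apply: eq_bigr => j _; rewrite !mxE; ring.
Qed.

End singular_value_decomposition.

(** * Open sets of the plane *)

Section plane_open_sets.
Context {R : realType}.
Implicit Types (Om : set (plane R)) (z : plane R).

Lemma open_plane_ball Om z : open Om -> Om z -> exists2 e : R, 0 < e &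
  forall x y : R, `|z.1 - x| < e -> `|z.2 - y| < e -> Om (x, y).
Proof.
move=> oO Oz; have : nbhs z Om by exact: open_nbhs_nbhs.
move=> [[/= A B] [/nbhs_ballP[a a0 aA] /nbhs_ballP[b b0 bB]] AB].
exists (Num.min a b) => [|x y xa yb]; first by rewrite lt_min a0.
by apply: AB; split; [apply: aA|apply: bB];
  rewrite /ball/=; [apply: lt_le_trans xa _|apply: lt_le_trans yb _];
  rewrite ge_min lexx ?orbT.
Qed.

(** The sigma-algebra on the plane is the product of two Borel sigma-algebras,
    and an open set is the union of the rational open boxes inside it. *)
Lemma measurable_open_plane Om : open Om -> measurable Om.
Proof.
move=> oO.
pose box (q : rat * rat * (rat * rat)) : set (plane R) :=
  [set` `](ratr q.1.1 : R), ratr q.1.2[%R] `*` [set` `](ratr q.2.1 : R), ratr q.2.2[%R].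
pose F q := if pselect (box q `<=` Om) then box q else set0.
have -> : Om = \bigcup_q F q.
  apply/seteqP; split => [z Oz|z [q _]]; last first.
    by rewrite /F; case: pselect => [sub /sub|_ []].
  have [e e0 eO] := open_plane_ball oO Oz.
  have lt_e (x : R) : x - e < x by rewrite gtrBl.
  have gt_e (x : R) : x < x + e by rewrite ltrDl.
  have [a1] := rat_in_itvoo (lt_e z.1).
  have [b1] := rat_in_itvoo (gt_e z.1).
  have [a2] := rat_in_itvoo (lt_e z.2).
  have [b2] := rat_in_itvoo (gt_e z.2).
  rewrite !in_itv/= => /andP[b2l b2r] /andP[a2l a2r] /andP[b1l b1r] /andP[a1l a1r].
  exists ((a1, b1), (a2, b2)) => //; rewrite /F; case: pselect => [sub|nsub].
    by split; rewrite /= in_itv/= ?a1r ?a2r.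
  exfalso; apply: nsub.
  move=> [x y] [/=]; rewrite !in_itv/= => /andP[xa xb] /andP[ya yb].
  by apply: eO; rewrite ltr_norml; apply/andP; split; lra.
apply: countable_bigcupT_measurable => [|q]; first exact: countableP.
rewrite /F; case: pselect => [sub|nsub]; last exact: measurable0.
by apply: measurableX; exact: measurable_itv.
Qed.

Lemma open_plane_disjoint_rectangles Om : open Om -> Om !=set0 ->
  exists E : nat -> set (plane R),
  [/\ forall l, measurable (E l), forall l, E l `<=` Om,
      forall l, (0 < plane_measure R (E l) < +oo)%E
    & forall i j, i != j -> E i `&` E j = set0].
Proof.
move=> oO [z Oz]; have [e e0 eO] := open_plane_ball oO Oz.
(* the rectangles accumulate at the vertical line through [z] *)
pose a (l : nat) : R := z.1 + e / l.+1%:R.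
have a_lt l : a l.+1 < a l.
  by rewrite ltrD2l ltr_pM2l// ltf_pV2 ?posrE ?ltr0n// ltr_nat.
have a_le i j : (i <= j)%N -> a j <= a i.
  by move=> ij; rewrite lerD2l ler_pM2l// lef_pV2 ?posrE ?ltr0n// ler_nat.
pose E l : set (plane R) :=
  [set` `](a l.+1), (a l)[%R] `*` [set` `](z.2 - e), (z.2 + e)[%R].
exists E; split.
- by move=> l; apply: measurableX; exact: measurable_itv.
- move=> l [x y] [/=]; rewrite !in_itv/= => /andP[xa xb] /andP[ya yb].
  apply: eO; rewrite ltr_norml; apply/andP; split; try lra.
    have : a l <= z.1 + e.
      by rewrite /a lerD2l ler_pdivrMr ?ltr0n// ler_peMr ?(ltW e0)// ler1n.
    lra.
  have : z.1 < a l.+1 by rewrite /a ltrDl divr_gt0// ltr0n.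
  lra.
- move=> l; have -> : plane_measure R (E l) =
      (@lebesgue_measure R [set` `](a l.+1), (a l)[%R] *
       @lebesgue_measure R [set` `](z.2 - e), (z.2 + e)[%R])%E.
    by apply: product_measure1E; exact: measurable_itv.
  rewrite !lebesgue_measure_itv/= !lte_fin a_lt (_ : z.2 - e < z.2 + e); last by lra.
  by rewrite -!EFinD -EFinM lte_fin ltry andbT mulr_gt0// subr_gt0//; lra.
move=> i j; wlog ij : i j / (i < j)%N => [H|_].
  rewrite neq_ltn => /orP[ij|ji]; first by apply: H => //; rewrite ltn_eqF.
  by rewrite setIC; apply: H => //; rewrite ltn_eqF.
apply/seteqP; split => // -[x y] [[/= + _] [/= + _]]; rewrite !in_itv/=.
move=> /andP[xi _] /andP[_ xj].
by have := lt_trans xi (lt_le_trans xj (a_le _ _ ij)); rewrite ltxx.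
Qed.

End plane_open_sets.

(** * Norms in terms of singular values *)

Section L2_singular_values.
Context {R : realType} (Om : set (plane R)).
Hypothesis oOm : open Om.
Hypothesis nOm : Om !=set0.
Local Notation pm := (plane_measure R).

Let mOm : measurable Om. Proof. exact: measurable_open_plane. Qed.

Lemma singular_valuesP k (h : plane R -> 'cV[R]_k) : L2 Om h ->
  is_singular_values Om h (singular_values Om h).
Proof.
move=> sh; apply: xgetPex.
have [E [mE ED muE tE]] := open_plane_disjoint_rectangles oOm nOm.
have sh' i : sqint pm Om (fun z => h z i 0) by have [] := sh i.
have [s [u [v [orthu sv orthv [s0 s_le] hE]]]] :=
  singular_value_decomposition mOm mE ED muE tE sh'.
exists [tuple s j | j < k]; exists u, v; split => //.
- move=> j i; have [mv v2] := sv j; split.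
    by under eq_fun do rewrite mxE.
  by under eq_fun do rewrite mxE.
- split=> [j|i j ij]; rewrite !tnth_mktuple //.
  exact: s_le.
- apply: filterS hE => z hz Oz; apply/colP => i; rewrite hz// summxE.
  by apply: eq_bigr => j _; rewrite mxE tnth_mktuple.
Qed.

Section singular_value_norms.
Variables (k : nat) (h : plane R -> 'cV[R]_k) (s : k.-tuple R).
Variables (u : 'I_k -> 'cV[R]_k) (v : 'I_k -> plane R -> R).
Hypothesis sh : L2 Om h.
Hypothesis orthu : forall i j, \sum_(l < k) u i l 0 * u j l 0 = (i == j)%:R.
Hypothesis sv : forall j, L2 Om (fun z => const_mx (v j z) : 'cV[R]_1).
Hypothesis orthv : forall i j,
  \int[plane_measure R]_(z in Om) (v i z * v j z) = (i == j)%:R.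
Hypothesis hE : L2_eq Om h (fun z => \sum_(j < k) (tnth s j * v j z) *: u j).

Let sqint_v j : sqint pm Om (v j).
Proof.
have [] := sv j 0.
under eq_fun do rewrite mxE.
by under [X in _ -> pm.-integrable _ X -> _]eq_fun do rewrite mxE.
Qed.

(** Parseval's identity for [x^T h], whose coefficient on [v j] is
    [s_j * (x^T u_j)].  Only a function almost everywhere equal to [x^T h] is
    given, because the value of an operator on [L^2] is only determined up to
    a null set. *)
Lemma norm_linear_image (x : 'cV[R]_k) (g : plane R -> R) :
  measurable_fun Om g -> {ae pm, forall z, Om z -> g z = \sum_l x l 0 * h z l 0} ->
  \int[pm]_(z in Om) (g z ^+ 2) =
  \sum_j tnth s j ^+ 2 * (\sum_l x l 0 * u j l 0) ^+ 2.
Proof.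
move=> mg gE.
pose c j := tnth s j * \sum_l x l 0 * u j l 0.
pose f z := \sum_j c j * v j z.
have sf : sqint pm Om f by exact: sqint_sum.
have gf : {ae pm, forall z, Om z -> g z = f z}.
  apply: filterS2 gE hE => z gz hz Oz; rewrite gz// hz// /f /c.
  under eq_bigr do rewrite summxE mulr_sumr.
  rewrite exchange_big/=; apply: eq_bigr => j _.
  by rewrite mulr_sumr mulr_suml; apply: eq_bigr => l _; rewrite !mxE; ring.
transitivity (ip pm Om f f).
  rewrite /ip /Rintegral; congr fine; apply: ae_eq_integral => //.
  - by apply/measurable_EFinP; exact: measurable_funX.
  - by apply/measurable_EFinP; apply: measurable_funM; exact: sf.1.
  by apply: filterS gf => z gz Oz; rewrite gz// expr2.
rewrite ip_suml//; apply: eq_bigr => j _.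
rewrite ipC ip_suml// (bigD1 j)//= [ip _ _ _ _]orthv eqxx mulr1.
rewrite big1 ?addr0 => [|i ij]; last by rewrite [ip _ _ _ _]orthv (negbTE ij) mulr0.
by rewrite /c; ring.
Qed.

(** Sum [norm_linear_image] over the coordinate vectors. *)
Lemma L2_norm_singular_values : L2_norm Om h ^+ 2 = \sum_j tnth s j ^+ 2.
Proof.
rewrite /L2_norm sqr_sqrtr; last first.
  by apply: Rintegral_ge0 => z _; apply: sumr_ge0 => i _; exact: sqr_ge0.
have -> : \int[pm]_(z in Om) (\sum_(i < k) h z i 0 ^+ 2) =
    \sum_(i < k) \int[pm]_(z in Om) (h z i 0 ^+ 2).
  by apply: Rintegral_sum => // i; have [] := sh i.
have E i : \int[pm]_(z in Om) (h z i 0 ^+ 2) =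
    \sum_j tnth s j ^+ 2 * u j i 0 ^+ 2.
  rewrite (@norm_linear_image (delta_mx i 0)).
  - apply: eq_bigr => j _; congr (_ * _ ^+ 2).
    rewrite (bigD1 i)//= mxE !eqxx mul1r big1 ?addr0// => l li.
    by rewrite mxE (negbTE li) mul0r.
  - by have [] := sh i.
  apply: aeW => z _; rewrite (bigD1 i)//= mxE !eqxx mul1r big1 ?addr0// => l li.
  by rewrite mxE (negbTE li) mul0r.
under eq_bigr do rewrite E.
rewrite exchange_big/=; apply: eq_bigr => j _; rewrite -mulr_sumr.
by under eq_bigr do rewrite expr2; rewrite orthu eqxx mulr1.
Qed.

End singular_value_norms.

End L2_singular_values.

(** * Reduction to bilinear forms *)

Lemma zero_pad_linear_form (R : realType) (N : nat) (V : 'cV[R]_N)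
    (f : plane R -> 'cV[R]_N) :
  zero_pad N (fun z => V^T *m f z) =
  fun z => (\matrix_(i < N, j < N) ((val i == 0)%N%:R * V j 0)) *m f z.
Proof.
apply/funext => z; apply/colP => i; rewrite !mxE.
case: insubP => [j _ ji|i0].
  have i0 : val i = 0%N by rewrite -ji ord1.
  rewrite ord1 mxE; apply: eq_bigr => l _; rewrite !mxE i0 eqxx mul1r//.
rewrite big1// => l _; rewrite mxE.
by case: (val i) i0 => //= n _; rewrite !mul0r.
Qed.

(** The zero-padded function [V^T f] is [B f] for the matrix [B] with first row
    [V^T] and other rows zero, so commutation with [B] gives the first
    coordinate of [A (B f)]. *)
Lemma short_op_linear_form (R : realType) (Om : set (plane R)) (N : nat)
    (N0 : (0 < N)%N) (W : set (plane R -> 'cV[R]_N))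
    (A : (plane R -> 'cV[R]_N) -> (plane R -> 'cV[R]_N))
    (f : plane R -> 'cV[R]_N) (V : 'cV[R]_N) :
  L2_operator Om W A -> commutes_with_linear_maps Om W A -> W f ->
  let g z := short_op N0 A (fun z => V^T *m f z) z 0 0 in
  measurable_fun Om g /\
  {ae plane_measure R, forall z, Om z -> g z = (V^T *m A f z) 0 0}.
Proof.
move=> [AL2 _] AB Wf g.
pose B : 'M[R]_N := \matrix_(i, j) ((val i == 0)%N%:R * V j 0).
have [WB ABf] := AB f B Wf.
have gE : g = fun z => A (fun z => B *m f z) z (widen_ord N0 0) 0.
  by apply/funext => z; rewrite /g /short_op mxE zero_pad_linear_form.
split; first by rewrite gE; have [] := AL2 _ WB (widen_ord N0 0).
rewrite gE; apply: filterS ABf => z Az Oz; rewrite Az// !mxE.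
by apply: eq_bigr => l _; rewrite !mxE/= mul1r.
Qed.

(** The identity [(v (x) u)^T vec X = u^T X v]. *)
Lemma kron_vector_bilinear (d : measure_display) (T : measurableType d)
    (R : realType) (P : probability T R) (m n : nat)
    (u : 'I_m -> {RV P >-> R}) (v : 'I_n -> {RV P >-> R}) (x : 'cV[R]_(n * m)) t :
  \sum_l kron_vector u v t l 0 * x l 0 =
  bilinear u v (fun j i => x (mxtens_index (j, i)) 0) t.
Proof.
rewrite /bilinear.
under [RHS]eq_bigr do rewrite mulr_suml.
rewrite exchange_big pair_big /=.
rewrite (reindex (@mxtens_index n m)) /=; last first.
  by exists (@mxtens_unindex n m) => l _; rewrite (mxtens_indexK, mxtens_unindexK).
apply: eq_bigr => -[j i] _; rewrite /kron_vector mxE mxtens_indexK !mxE /=; ring.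
Qed.

Theorem theorem3p4 (R : realType) (Om : set (plane R)) (m n : nat)
    (m_gt0 : (0 < m)%N) (n_gt0 : (0 < n)%N)
    (W : set (plane R -> 'cV[R]_(n * m)))
    (A : (plane R -> 'cV[R]_(n * m)) -> (plane R -> 'cV[R]_(n * m)))
    (f : plane R -> 'cV[R]_(n * m))
    (d : measure_display) (T : measurableType d) (P : probability T R)
    (u : 'I_m -> {RV P >-> R}) (v : 'I_n -> {RV P >-> R}) (tau : R) :
  plane_domain Om ->
  L2_subspace Om W -> L2_operator Om W A ->
  commutes_with_linear_maps Om W A ->
  W f -> ~ L2_eq Om (fun z => f z - A f z) (fun=> 0) ->
  independent_gaussian_vectors u v ->
  1 < tau ->
  let rho := stable_rank Om (fun z => f z - A f z) in
  let err := L2_norm Om (fun z => f z - A f z) in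
  let V := kron_vector u v in
  let VTf := fun t z => (V t)^T *m f z in
  let err_V := fun t =>
    L2_norm Om (fun z => VTf t z - short_op (muln_pos m_gt0 n_gt0) A (VTf t) z) in
  (P [set t | (tau * Num.sqrt rho * err_V t <= err)%R]
     <= (2 / pi * (2 + ln (1 + 2 * tau)) * tau^-1)%:E)%E
  /\
  (P [set t | (err <= tau^-1 * err_V t)%R]
     <= (Num.sqrt (2 * tau) * expR (- tau + 2))%:E)%E.
Proof.
move=> [oOm _ nOm] [WL2 _ _ _] A2 AB Wf f_neq0 uv tau1 rho err V VTf err_V.
have tau0 : 0 < tau by rewrite (lt_trans _ tau1).
pose N0 := muln_pos m_gt0 n_gt0; pose o : 'I_(n * m) := Ordinal N0.
have mOm : measurable Om by exact: measurable_open_plane.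
pose h z := f z - A f z.
have sh : L2 Om h.
  move=> i; have := sqintDZ mOm (-1) (WL2 _ Wf i) (A2.1 _ Wf i).
  rewrite (_ : (fun z => _) = fun z => h z i 0)//.
  by apply/funext => z; rewrite !mxE mulN1r.
have [u' [v' [orthu sv orthv [s0 s_le] hE]]] := singular_valuesP oOm nOm sh.
set s := singular_values Om h in s0 s_le hE.
have err2 : err ^+ 2 = \sum_j tnth s j ^+ 2.
  exact: (L2_norm_singular_values oOm sh orthu sv orthv hE).
have err0 : 0 <= err by exact: sqrtr_ge0.
have so : 0 < tnth s o.
  rewrite lt_neqAle s0 andbT; apply/eqP => so0; apply: f_neq0.
  have sj0 j : tnth s j = 0.
    by apply/eqP; rewrite eq_le s0 andbT so0 s_le.
  apply: filterS hE => z hz Oz; rewrite -[LHS]/(h z) hz//.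
  by apply: big1 => j _; rewrite sj0 mul0r scale0r.
have err_gt0 : 0 < err.
  rewrite lt_neqAle err0 andbT eq_sym -sqrf_eq0 err2 gt_eqF//.
  rewrite (bigD1 o)//= ltr_pwDl ?exprn_gt0//.
  by apply: sumr_ge0 => j _; exact: sqr_ge0.
have rhoE : Num.sqrt rho = err / tnth s o.
  rewrite /rho /stable_rank -/h -/s -/err (_ : head 0 s = tnth s o).
    by rewrite -expr_div_n sqrtr_sqr ger0_norm// divr_ge0.
  by rewrite (tnth_nth 0) nth0.
(* [u' k] reshaped into a matrix *)
pose c k j i := u' k (mxtens_index (j, i)) 0.
pose Q t := \sum_k tnth s k ^+ 2 * bilinear u v (c k) t ^+ 2.
have c1 k : \sum_j \sum_i c k j i ^+ 2 = 1.
  transitivity (\sum_l u' k l 0 * u' k l 0); last by rewrite orthu eqxx.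
  rewrite pair_big [RHS](reindex (@mxtens_index n m))/=; last first.
    exists (@mxtens_unindex n m) => l _;
    by rewrite (mxtens_indexK, mxtens_unindexK).
  by apply: eq_bigr => -[j i] _; rewrite /c expr2.
have Q0 t : 0 <= Q t by apply: sumr_ge0 => k _; rewrite mulr_ge0 ?sqr_ge0.
have mQ : measurable_fun setT Q.
  apply: measurable_sum => k; apply: measurable_funM => //.
  by apply: measurable_funX; exact: measurable_bilinear.
have err_VE t : err_V t = Num.sqrt (Q t).
  have [mg gE] := short_op_linear_form N0 (V t) A2 AB Wf.
  rewrite /err_V /L2_norm; congr Num.sqrt.
  pose g z := (VTf t z) 0 0 - short_op N0 A (VTf t) z 0 0.
  transitivity (\int[plane_measure R]_(z in Om) (g z ^+ 2)).
    apply: eq_Rintegral => z _; rewrite big_ord1 mxE [ord0]ord1 /g; congr ((_ + _) ^+ 2).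
    by rewrite [LHS]mxE.
  rewrite (norm_linear_image oOm sv orthv hE (x := V t)).
  - by apply: eq_bigr => k _; rewrite kron_vector_bilinear.
  - apply: measurable_funB => //.
    rewrite (_ : (fun z => _) = fun z => \sum_l V t l 0 * f z l 0).
      apply: measurable_sum => l; apply: measurable_funM => //.
      by have [] := WL2 _ Wf l.
    by apply/funext => z; rewrite mxE; apply: eq_bigr => l _; rewrite mxE.
  apply: filterS gE => z gz Oz; rewrite /g gz// !mxE -sumrB.
  by apply: eq_bigr => l _; rewrite !mxE; ring.
have mZ k : measurable_fun setT (bilinear u v (c k)) by exact: measurable_bilinear.
have le_Q k t : tnth s k * `|bilinear u v (c k) t| <= Num.sqrt (Q t).
  rewrite -[X in X * _]ger0_norm// -normrM -sqrtr_sqr ler_wsqrtr//.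
  rewrite exprMn /Q (bigD1 k)//= lerDl.
  by apply: sumr_ge0 => l _; rewrite mulr_ge0 ?sqr_ge0.
have mset (F : T -> R) a : measurable_fun setT F -> measurable [set t | F t <= a].
  move=> mF; rewrite (_ : [set t | _] = F @^-1` [set` `]-oo, a]]); last first.
    by apply/seteqP; split => t /=; rewrite in_itv.
  by rewrite -[X in measurable X]setTI; apply: mF => //; exact: measurable_itv.
have msQ : measurable_fun setT (fun t => Num.sqrt (Q t)).
  exact: (measurableT_comp (continuous_measurable_fun (@sqrt_continuous R)) mQ).
split.
- have := bilinear_small_ball uv (c1 o) tau1; apply: le_trans.
  apply: le_measure; rewrite ?inE.
  + under eq_fun do rewrite err_VE; apply: mset; exact: measurable_funM.
  + apply: (mset (fun t => `|bilinear u v (c o) t|)); exact: measurableT_comp.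
  move=> t /=; rewrite err_VE rhoE => le_err.
  rewrite -(ler_pM2l so) (le_trans (le_Q o t))//.
  rewrite ler_pdivlMr//; move: le_err.
  rewrite (_ : _ * _ * _ = err * (Num.sqrt (Q t) * tau / tnth s o)); last by ring.
  by rewrite ger_pMr// ler_pdivrMr// mul1r.
- pose p k := tnth s k ^+ 2 / err ^+ 2.
  have p0 k : 0 <= p k by rewrite divr_ge0 ?sqr_ge0.
  have p1 : \sum_k p k = 1.
    by rewrite -mulr_suml -err2 mulfV// sqrf_eq0 gt_eqF.
  have := bilinear_tail uv p0 p1 c1 tau1.
  rewrite (_ : [set t | tau ^+ 2 <= _] = [set t | err <= tau^-1 * err_V t])//.
  apply/funext => t /=; apply/propext.
  have -> : \sum_k p k * bilinear u v (c k) t ^+ 2 = Q t / err ^+ 2.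
    by rewrite /Q mulr_suml; apply: eq_bigr => k _; rewrite /p mulrAC.
  rewrite err_VE ler_pdivlMl// ler_pdivlMr ?exprn_gt0// -exprMn.
  rewrite -ler_sqrt// sqrtr_sqr ger0_norm//.
  by rewrite mulr_ge0// ltW.
Qed.
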